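(* Let $q=2^e$ with $e\ge 2$ even, let $\alpha$ be a cube in $\mathbb F_q^*$, and let $f_\alpha:\mathbb F_{q^2}\to\mathbb F_2$ be $f_\alpha(x)=\operatorname{Tr}_{q^2}\bigl(\alpha(\sigma^{-1}(x))^3\bigr)$. Then $f_\alpha$ is $2$-plateaued on $\mathbb F_{q^2}$. As $\beta$ ranges over all of $\mathbb F_{q^2}$, the Walsh coefficient $W_{f_\alpha}(\beta)$ takes the value $2q$ exactly $\frac{q(q+2)}{8}$ times, the value $-2q$ exactly $\frac{q(q-2)}{8}$ times, and the value $0$ exactly $\frac{3q^2}{4}$ times. Consequently, the nonlinearity of $f_\alpha$ is $q^2/2-q$.
   Context: $\mathbb F_q$ is regarded as the subfield of order $q$ of $\mathbb F_{q^2}$. $\operatorname{Tr}_{q^2}:\mathbb F_{q^2}\to\mathbb F_2$ is the absolute trace. Put $d=(q^2+q+1)/3$, an integer since $q\equiv 1\pmod 3$. The map $\sigma(X)=X+X^d+X^{dq}$ is a permutation of $\mathbb F_{q^2}$ (a known theorem of Ding, Qu, Wang, Yuan and Yuan), and $\sigma^{-1}$ denotes its inverse permutation. For a Boolean function $f:\mathbb F_{q^2}\to\mathbb F_2$, the Walsh transform is $W_f(\beta)=\sum_{x\in\mathbb F_{q^2}}(-1)^{f(x)+\operatorname{Tr}_{q^2}(\beta x)}\in\mathbb Z$ for $\beta\in\mathbb F_{q^2}$. A Boolean function on $\mathbb F_{2^n}$ is $s$-plateaued if all its Walsh coefficients belong to $\{0,\pm 2^{(n+s)/2}\}$; here $n=2e$,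 so $2$-plateaued means that all Walsh coefficients lie in $\{0,\pm 2q\}$. The nonlinearity of a Boolean function $f$ on $\mathbb F_{q^2}$ is its minimum Hamming distance to the affine functions $x\mapsto \operatorname{Tr}_{q^2}(\beta x)+\epsilon$ ($\beta\in\mathbb F_{q^2}$, $\epsilon\in\mathbb F_2$), equivalently $\frac{q^2}{2}-\frac12\max_{\beta\in\mathbb F_{q^2}}|W_f(\beta)|$. *)

(* Defs.v *)
From HB Require Import structures.
From mathcomp Require Import all_boot all_order all_fingroup all_algebra all_field.
From mathcomp Require Import ring zify.

Set Implicit Arguments.
Unset Strict Implicit.
Unset Printing Implicit Defensive.

Import GRing.Theory Num.Theory.

Local Open Scope ring_scope.

Section BooleanFunctions.

Variable L : finFieldType.

Implicit Types (x b : L) (f g : L -> 'F_2).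

Definition ffdegree : nat := logn 2 #|L|.

(* The sum x + x^2 + x^4 + ... + x^(2^(n-1)), as an element of L. *)
Definition trace_sum x : L := \sum_(i < ffdegree) x ^+ (2 ^ i).

(* trace_sum x is 0 or 1 when L has order 2 ^ n (see absTr_natr), so this only
   moves its value from L to its prime field 'F_2. *)
Definition absTr x : 'F_2 := if trace_sum x == 0 then 0 else 1.

(* The exponent is the representative in {0, 1} of an element of 'F_2. *)
Definition walsh f b : int := \sum_(x : L) (-1) ^+ (f x + absTr (b * x))%R.

(* The real number 2^((n+s)/2) is irrational when n + s is odd; then no Boolean
   function can be s-plateaued (by Parseval), hence the parity condition. *)
Definition plateaued (s : nat) f : Prop :=
  ~~ odd (ffdegree + s) /\
  forall b, let w : int := 2 ^+ (ffdegree + s)./2 in walsh f b \in [:: 0; w; - w].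

Definition hamming_dist f g : nat := #|[set x | f x != g x]|.

Definition affine_fun (p : L * 'F_2) x : 'F_2 := absTr (p.1 * x) + p.2.

Definition nonlinearity f : nat :=
  \big[minn/hamming_dist f (affine_fun (0, 0))]_(p : L * 'F_2)
     hamming_dist f (affine_fun p).

End BooleanFunctions.

Section SubFq.

Variables (L : finFieldType) (q : nat).

(* The elements of the subfield of order q of L, when #|L| is a power of q. *)
Definition subFq : {pred L} := [pred x | x ^+ q == x].

(* The division is exact when q = 1 mod 3, e.g. when q = 2 ^ e with e even. *)
Definition sigma_exp : nat := (q ^ 2 + q + 1) %/ 3.

Definition sigma (x : L) : L := x + x ^+ sigma_exp + x ^+ (sigma_exp * q).

End SubFq.

Section Trace.

Variables (L : finFieldType) (n : nat).
Hypothesis cardL : #|L| = (2 ^ n)%N.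

Lemma pchar_two : 2%N \in [pchar L].
Proof. exact: card_finPcharP cardL _. Qed.

Lemma exprD_pow2 (i : nat) (x y : L) :
  (x + y) ^+ (2 ^ i) = x ^+ (2 ^ i) + y ^+ (2 ^ i).
Proof. by rewrite exprDn_pchar // (eq_pnat _ (pcharf_eq pchar_two)) pnatX. Qed.

Lemma absTr_natr (x : L) : (absTr x)%:R = trace_sum x.
Proof.
have sqr_sum (r : seq nat) (F : nat -> L) :
    (\sum_(i <- r) F i) ^+ 2 = \sum_(i <- r) F i ^+ 2.
  elim: r => [|i r IHr]; first by rewrite !big_nil expr0n.
  by rewrite !big_cons (exprD_pow2 1) IHr.
have idem : trace_sum x ^+ 2 = trace_sum x.
  rewrite /trace_sum /ffdegree cardL pfactorK //.
  rewrite -(big_mkord xpredT (fun i => x ^+ (2 ^ i))) sqr_sum.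
  rewrite [LHS](eq_bigr (fun i => x ^+ (2 ^ i.+1))) => [|i _]; last first.
    by rewrite -exprM -expnSr.
  case: n cardL => [|m] cL; first by rewrite !big_geq.
  rewrite big_nat_recr //= -cL expf_card [RHS]big_nat_recl //= addrC.
  by rewrite expn0 expr1.
rewrite /absTr; have [->|nz] := eqVneq (trace_sum x) 0; first by [].
by apply: (mulfI nz); rewrite -expr2 idem mulr1.
Qed.

End Trace.

(* The theorem of Ding, Qu, Wang, Yuan and Yuan that sigma is a permutation. *)
Section SigmaPermutation.

Variables (L : finFieldType) (e : nat).
Let q := (2 ^ e)%N.
Hypothesis e_even : ~~ odd e.
Hypothesis cardL : #|L| = (q ^ 2)%N.

Let bar (x : L) := x ^+ q.
Let k := (q %/ 3)%N.
Let d := sigma_exp q.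

Let qE : q = (3 * k).+1.
Proof.
have q3 : q = 1 %[mod 3].
  by rewrite /q -(odd_double_half e) (negbTE e_even) add0n -mul2n expnM -modnXm exp1n.
by rewrite {1}(divn_eq q 3) q3 /k; lia.
Qed.

Let d3 : (3 * d = q ^ 2 + q + 1)%N.
Proof.
rewrite /d /sigma_exp mulnC divnK // qE; apply/dvdnP.
by exists (3 * k * k + 3 * k + 1)%N; lia.
Qed.

Let dE : d = ((3 * k) * k.+1).+1.
Proof. by move: d3; rewrite qE; nia. Qed.

Let cardL2 : #|L| = (2 ^ (e * 2))%N.
Proof. by rewrite cardL expnM. Qed.

Let barD x y : bar (x + y) = bar x + bar y.
Proof. exact: exprD_pow2 cardL2 _ _ _. Qed.

Let barM x y : bar (x * y) = bar x * bar y.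
Proof. exact: exprMn. Qed.

Let barX x n : bar (x ^+ n) = bar x ^+ n.
Proof. by rewrite /bar -!exprM mulnC. Qed.

Let barK x : bar (bar x) = x.
Proof. by rewrite /bar -exprM -[RHS]expf_card cardL. Qed.

Let expd_bar x : bar x = x -> x ^+ d = x.
Proof.
move=> bx; rewrite dE; elim: k.+1 => [|m IHm]; first by rewrite muln0.
by rewrite mulnS -addnS exprD IHm -exprSr -qE.
Qed.

Let sigma_key (x : L) : exists t : L,
  [/\ sigma q x = x + t, bar t = t,
      bar (sigma q x) = bar x + t
    & (sigma q x ^+ 2 + sigma q x * bar (sigma q x) + bar (sigma q x) ^+ 2) * t
      = sigma q x * bar (sigma q x) * (sigma q x + bar (sigma q x))].
Proof.
pose y := x ^+ d; pose t := y + bar y.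
have sE : sigma q x = x + t by rewrite /sigma exprM addrA.
have bt : bar t = t by rewrite barD barK addrC.
have sbE : bar (sigma q x) = bar x + t by rewrite sE barD bt.
have y3 : y ^+ 3 = x ^+ 2 * bar x.
  rewrite /y -exprM mulnC d3 addn1 exprS exprD -cardL expf_card.
  by rewrite mulrA -expr2.
have z3 : bar y ^+ 3 = bar x ^+ 2 * x.
  by rewrite -barX y3 barM barX barK.
have yz : y * bar y = x * bar x.
  by rewrite /y barX -exprMn expd_bar // barM barK mulrC.
have t3 : t ^+ 3 = x * bar x * (x + bar x + 3%:R * t).
  have -> : t ^+ 3 = y ^+ 3 + bar y ^+ 3 + 3%:R * (y * bar y) * t.
    by rewrite /t; ring.
  by rewrite y3 z3 yz; ring.
exists t; split=> //; rewrite sbE sE; apply/subr0_eq.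
transitivity (t ^+ 3 - x * bar x * (x + bar x + 3%:R * t)); first by ring.
by rewrite t3 subrr.
Qed.

Let norm_form_eq0 (s : L) : s ^+ 2 + s * bar s + bar s ^+ 2 = 0 -> s = 0.
Proof.
move=> D0.
have s3 : bar s ^+ 3 = s ^+ 3.
  apply/subr0_eq.
  transitivity ((bar s - s) * (s ^+ 2 + s * bar s + bar s ^+ 2)); first by ring.
  by rewrite D0 mulr0.
have sE : s = s ^+ (3 * k) * bar s.
  rewrite -[LHS]barK {1}/bar {1}qE exprSr exprM s3 -exprM //.
have s2 : s ^+ 2 = bar s ^+ 2.
  by rewrite expr2 {2}sE mulrA -exprS -qE -expr2.
move: D0; rewrite -s2 addrAC (addrr_pchar2 (pchar_two cardL2)) add0r => /eqP.
rewrite mulf_eq0 => /orP[/eqP //|/eqP b0].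
by rewrite -(barK s) b0 /bar expr0n qE.
Qed.

Lemma sigma_inj_subproof : injective (@sigma L q).
Proof.
have ker0 (w : L) : sigma q w = 0 -> w = 0.
  move=> w0; have [v [sw _ bsw _]] := sigma_key w.
  have bw : bar w = w.
    by apply: (addIr v); rewrite -sw -bsw w0 /bar expr0n qE.
  move: w0; rewrite /sigma exprM -/d (expd_bar bw) -/(bar w) bw.
  by rewrite (addrr_pchar2 (pchar_two cardL2)) add0r.
move=> x z exz.
have [s0|Dn0] :=
  eqVneq (sigma q x ^+ 2 + sigma q x * bar (sigma q x) + bar (sigma q x) ^+ 2) 0.
  have s00 := norm_form_eq0 s0.
  by rewrite (ker0 x s00) (ker0 z) // -exz.
have [t [sx _ _ tE]] := sigma_key x; have [u [sz _ _ uE]] := sigma_key z.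
rewrite -exz in sz uE.
have tu : t = u by apply: (mulfI Dn0); rewrite tE uE.
by apply: (addIr t); rewrite -sx sz tu.
Qed.

End SigmaPermutation.

Lemma sigma_inj (L : finFieldType) (e : nat) :
  ~~ odd e -> #|L| = ((2 ^ e) ^ 2)%N -> injective (@sigma L (2 ^ e)).
Proof. exact: sigma_inj_subproof. Qed.

Definition sigma_perm (L : finFieldType) (e : nat) (e_even : ~~ odd e)
    (cardL : #|L| = ((2 ^ e) ^ 2)%N) : {perm L} :=
  perm (sigma_inj e_even cardL).

Definition f_alpha (L : finFieldType) (e : nat) (e_even : ~~ odd e)
    (cardL : #|L| = ((2 ^ e) ^ 2)%N) (alpha x : L) : 'F_2 :=
  absTr (alpha * ((sigma_perm e_even cardL)^-1)%g x ^+ 3).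

(* Main.v *)
Require Import Defs.
From mathcomp Require Import all_boot all_order all_fingroup all_algebra all_field.
From mathcomp Require Import ring zify.

Set Implicit Arguments.
Unset Strict Implicit.
Unset Printing Implicit Defensive.

Import GRing.Theory Num.Theory.
Local Open Scope ring_scope.

(** Put q = 2^e, let bar be the conjugation x |-> x^q of L, let chi be the
    character x |-> (-1)^Tr(x), and let w be a primitive cube root of unity; as
    e is even, w lies in the subfield of order q.

    The permutation sigma is linearized by a change of variable: for p != 0 and
    G = p + w^2 bar p, it sends G^3 / (p bar p) to w^2 p + w bar p
    (sigma_param).  In the variable p the function f_alpha becomes the monomial
    function p |-> Tr(alpha p^7 / (p bar p)^2), that is, Tr(alpha p^(5 - 2q))
    (chi_sigma_param), and a cube alpha = b^3 is absorbed by scaling p by b.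
    So W(beta) is the sum over p of chi(p^(5 - 2q) + gamma p), where gamma
    depends on beta only.

    Let g be a non-cube of the subfield of order q.  Every p != 0 is c y^2 bar y
    for exactly three pairs (c, y) with c in {1, g, g^2}, and then p^(5 - 2q) is
    c^3 y^8 bar y.  Hence 3 W(beta) = Q_0 + Q_1 + Q_2 (walsh_herm_sum), where
    Q_i is the sum over y of chi(c^3 y^8 bar y + gamma c y^2 bar y) for c = g^i,
    the exponential sum of a quadratic form invariant under y |-> w y.  Its
    square is q^2 times the order of the radical, and Q_i = 1 mod 3 because the
    nonzero y come in orbits of length 3; so Q_i = (-2)^k q when the radical has
    order 4^k (herm_sum_cases).

    The nonzero elements z of the radical correspond, three to one, to the roots
    x = c bar z^3 of X^21 + a X^5 + b X + 1 in the cube class of c, where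
    a = (bar gamma)^8 and b = gamma^4; in particular k <= 3.  Let tau be
    x |-> x^4.  There is a 3 x 3 matrix A such that x is a root if and only if
    (1, x, x^5) A = x tau(1, x, x^5).  Then (1, x, x^5) is an eigenvector of
    N = A tau(A) ... tau^(e-1)(A), with eigenvalue x^((q^2-1)/3), the cubic
    residue symbol of x; conversely, by an argument of Hilbert 90 type, every
    eigenvalue of N that is a cube root of unity comes from a root
    (root_of_eigenvalue).  Now det N = 1, t = tr N is in F_4, and N preserves a
    sesquilinear form, which forces tr N^-1 = t^2.  So the characteristic
    polynomial of N is X^3 + t X^2 + t^2 X + 1, which is X^3 + 1 if t = 0 and
    (X + t)^3 otherwise.  Therefore either exactly one cube class contains roots,
    or each of the three classes contains exactly one
    (class_roots_dichotomy).  In the first case the Q_i are q, q and one of -2q,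
    4q, -8q, so W(beta) is 0, 2q or -2q; in the second case all three are -2q
    and W(beta) = -2q.

    Once the values are known to be 0 and +-2q, the sum of W and the sum of W^2
    over all beta determine how often each value is taken. *)

(** * The additive character of trace *)

(** A polynomial with exponents r^k, k < e, and nonzero linear coefficient has
    degree less than #|F|, so it does not vanish identically on F. *)
Lemma additive_poly_nonzero (F : finFieldType) (r e : nat) (c : nat -> F) :
  (1 < r)%N -> (0 < e)%N -> #|F| = (r ^ e)%N -> c 0%N != 0 ->
  exists z, \sum_(k < e) c k * z ^+ (r ^ k) != 0.
Proof.
move=> r_gt1 e_gt0 cardF c0.
pose P : {poly F} := \sum_(k < e) (c k *: 'X^(r ^ k)).
have PE z : P.[z] = \sum_(k < e) c k * z ^+ (r ^ k).
  by rewrite horner_sum; apply: eq_bigr => k _; rewrite hornerZ hornerXn.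
have P1 : P`_1 = c 0%N.
  rewrite coef_sum (bigD1 (Ordinal e_gt0)) //= coefZ coefXn eqxx mulr1 big1 ?addr0 // => i.
  rewrite -val_eqE /= coefZ coefXn => i0; case: eqP => [/eqP|]; last by rewrite mulr0.
  by rewrite -{1}(expn0 r) eqn_exp2l // eq_sym (negPf i0).
have Pn0 : P != 0 by apply: contraNneq c0 => P0; rewrite -P1 P0 coef0.
have szP : (size P <= (r ^ e.-1).+1)%N.
  apply: (leq_trans (size_sum _ _ _)); apply/bigmax_leqP => i _.
  apply: (leq_trans (size_scale_leq _ _)).
  by rewrite size_polyXn ltnS leq_exp2l // -ltnS prednK.
have [/existsP[z Pz] | ] := boolP [exists z : F, P.[z] != 0].
  by exists z; rewrite -PE.
rewrite negb_exists => /forallP all0.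
have := max_poly_roots Pn0 (rs := enum F); rewrite -cardE cardF enum_uniq => /(_ _ isT).
have -> : all (root P) (enum F).
  by apply/allP => z _; rewrite /root -[_ == _]negbK all0.
move/(_ isT)=> /leq_trans /(_ szP).
by rewrite ltnS leq_exp2l // -{1}(prednK e_gt0) ltnn.
Qed.

Section AdditiveCharacter.

Variables (L : finFieldType) (n : nat).
Hypothesis cardL : #|L| = (2 ^ n)%N.

(** The additive character x |-> (-1)^Tr(x), with values in the integers. *)
Definition chi (x : L) : int := (-1) ^+ absTr x.

Lemma two0 : 2%:R = 0 :> L.
Proof. exact: (pcharf0 (pchar_two cardL)). Qed.

Lemma addxx (x : L) : x + x = 0.
Proof. exact: addrr_pchar2 (pchar_two cardL) _. Qed.

Lemma oppxx (x : L) : - x = x.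
Proof. exact: oppr_pchar2 (pchar_two cardL) _. Qed.

Lemma F2_cases (a : 'F_2) : a = 0 \/ a = 1.
Proof. by case: a => [[|[|k]] lt_k] //; [left | right]; apply: val_inj. Qed.

Lemma natr_F2_inj : injective (fun a : 'F_2 => (a%:R : L)).
Proof.
move=> a b; case: (F2_cases a) => ->; case: (F2_cases b) => -> //= /eqP.
  by rewrite eq_sym oner_eq0.
by rewrite oner_eq0.
Qed.

Lemma natr_F2D (a b : 'F_2) : ((a + b)%R : nat)%:R = a%:R + b%:R :> L.
Proof.
case: (F2_cases a) => ->; case: (F2_cases b) => -> //=; rewrite ?addr0 ?add0r //.
by rewrite addxx.
Qed.

Lemma sign_F2D (a b : 'F_2) : (-1) ^+ (a + b)%R = (-1) ^+ a * (-1) ^+ b :> int.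
Proof. by case: (F2_cases a) => ->; case: (F2_cases b) => ->. Qed.

Lemma absTr_inj (x y : L) : trace_sum x = trace_sum y -> absTr x = absTr y.
Proof. by rewrite /absTr => ->. Qed.

Lemma trace_sumD (x y : L) : trace_sum (x + y) = trace_sum x + trace_sum y.
Proof.
by rewrite /trace_sum -big_split /=; apply: eq_bigr => i _; apply: exprD_pow2 cardL _ _ _.
Qed.

Lemma absTrD (x y : L) : absTr (x + y) = absTr x + absTr y.
Proof.
by apply: natr_F2_inj; rewrite natr_F2D !(absTr_natr cardL) trace_sumD.
Qed.

Lemma chiD (x y : L) : chi (x + y) = chi x * chi y.
Proof. by rewrite /chi absTrD sign_F2D. Qed.

Lemma absTr0 : absTr (0 : L) = 0.
Proof. by apply: (addrI (absTr (0 : L))); rewrite -absTrD !addr0. Qed.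

Lemma chi0 : chi 0 = 1.
Proof. by rewrite /chi absTr0. Qed.

Lemma chi_sqr (x : L) : chi (x ^+ 2) = chi x.
Proof.
rewrite /chi; congr (_ ^+ (nat_of_ord _)); apply: absTr_inj.
rewrite /trace_sum /ffdegree cardL pfactorK //.
rewrite -!(big_mkord xpredT (fun i => _ ^+ (2 ^ i))).
under eq_bigr => i _ do rewrite -exprM -expnS.
case: n cardL => [|m] cL; first by rewrite !big_geq.
rewrite big_nat_recr //= -cL expf_card [RHS]big_nat_recl //= addrC.
by rewrite expn0 expr1.
Qed.

Lemma chi_pow2 k (x : L) : chi (x ^+ (2 ^ k)) = chi x.
Proof. by elim: k => [|k IHk]; rewrite ?expr1 // expnSr exprM chi_sqr. Qed.

Lemma chi_chi (x : L) : chi x * chi x = 1.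
Proof. by rewrite -chiD addxx chi0. Qed.

Lemma chi_nontrivial : exists x : L, chi x = -1.
Proof.
have n_gt0 : (0 < n)%N.
  by case: n cardL => // /eqP; rewrite expn0 => /eqP c1; have := finRing_gt1 L; rewrite c1.
have [x] := additive_poly_nonzero (c := fun=> 1) (ltnSn 1) n_gt0 cardL (oner_neq0 L).
under eq_bigr => k _ do rewrite mul1r.
move=> tr_x; exists x; rewrite /chi /absTr /trace_sum /ffdegree cardL pfactorK //.
by rewrite (negPf tr_x).
Qed.

Lemma sum_chiM (b : L) : \sum_x chi (b * x) = if b == 0 then (2 ^ n)%:R else 0.
Proof.
case: eqVneq => [->|b0].
  by under eq_bigr => x _ do rewrite mul0r chi0; rewrite sumr_const cardL.
have [y cy] := chi_nontrivial.
suff : \sum_x chi (b * x) = - \sum_x chi (b * x) by lia.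
rewrite {1}(reindex_inj (addIr (b^-1 * y))) /= -sumrN; apply: eq_bigr => x _.
by rewrite mulrDr chiD mulrA divff // mul1r cy mulrN1.
Qed.

End AdditiveCharacter.

(** * Three by three matrices *)

(** Entries of a matrix are given by a function on natural numbers, so that the
    ordinals arising from an expansion reduce to numerals. *)

Lemma det3 (R : comNzRingType) (m : nat -> nat -> R) (M : 'M[R]_3) :
  (forall i j, M i j = m i j) ->
  \det M = m 0%N 0%N * (m 1%N 1%N * m 2%N 2%N - m 1%N 2%N * m 2%N 1%N)
         - m 0%N 1%N * (m 1%N 0%N * m 2%N 2%N - m 1%N 2%N * m 2%N 0%N)
         + m 0%N 2%N * (m 1%N 0%N * m 2%N 1%N - m 1%N 1%N * m 2%N 0%N).
Proof.
move=> mE; rewrite (expand_det_row _ 0) !big_ord_recl big_ord0 /cofactor.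
rewrite !(expand_det_row _ (@ord0 1)) !big_ord_recl !big_ord0 /cofactor !det_mx11 !mxE !mE /=.
rewrite /bump /=; ring.
Qed.

Lemma tr3 (R : pzRingType) (m : nat -> nat -> R) (M : 'M[R]_3) :
  (forall i j, M i j = m i j) -> \tr M = m 0%N 0%N + m 1%N 1%N + m 2%N 2%N.
Proof. by move=> mE; rewrite /mxtrace !big_ord_recl big_ord0 !mE /= addr0 addrA. Qed.

Lemma tr_adj3 (R : comNzRingType) (m : nat -> nat -> R) (M : 'M[R]_3) :
  (forall i j, M i j = m i j) ->
  \tr (\adj M) = (m 1%N 1%N * m 2%N 2%N - m 1%N 2%N * m 2%N 1%N)
    + (m 0%N 0%N * m 2%N 2%N - m 0%N 2%N * m 2%N 0%N)
    + (m 0%N 0%N * m 1%N 1%N - m 0%N 1%N * m 1%N 0%N).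
Proof.
move=> mE; rewrite /mxtrace !big_ord_recl big_ord0 !mxE /cofactor.
rewrite !(expand_det_row _ (@ord0 1)) !big_ord_recl !big_ord0 /cofactor !det_mx11 !mxE !mE /=.
rewrite /bump /=; ring.
Qed.

Lemma matrix_entries (R : nzRingType) n (M : 'M[R]_n.+1) :
  exists m : nat -> nat -> R, forall i j, M i j = m i j.
Proof. by exists (fun i j => M (inord i) (inord j)) => i j; rewrite !inord_val. Qed.

Lemma det3_add_scalar (R : comNzRingType) (x : R) (M : 'M[R]_3) :
  \det (x%:M + M) = x ^+ 3 + \tr M * x ^+ 2 + \tr (\adj M) * x + \det M.
Proof.
have [m mE] := matrix_entries M.
rewrite (det3 (m := fun i j => x *+ (i == j) + m i j)) => [|i j]; last by rewrite !mxE mE.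
rewrite (tr3 mE) (tr_adj3 mE) (det3 mE) /=; ring.
Qed.

Lemma mulmx_eq3 (R : pzRingType) (A B C : 'M[R]_3) (a b c : nat -> nat -> R) :
  (forall i j, A i j = a i j) -> (forall i j, B i j = b i j) -> (forall i j, C i j = c i j) ->
  (forall i j : 'I_3, a i 0%N * b 0%N j + a i 1%N * b 1%N j + a i 2%N * b 2%N j = c i j) ->
  A *m B = C.
Proof.
move=> aE bE cE abc; apply/matrixP => i j.
by rewrite mxE !big_ord_recl big_ord0 !aE !bE cE -abc /= addr0 addrA.
Qed.

(** * The monodromy matrix and the roots of a projective polynomial *)

(** The sum 1 + 4 + ... + 4^(k-1) = (4^k - 1) / 3. *)
Fixpoint geom4 (k : nat) : nat := if k is k'.+1 then (4 * geom4 k').+1 else 0.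

Lemma geom4E k : (3 * geom4 k).+1 = (4 ^ k)%N.
Proof. by elim: k => //= k IHk; rewrite expnS; lia. Qed.

(** In the application, rho x = (bar x)^2, a = (bar gamma)^8 and b = gamma^4. *)
Section Monodromy.

Variables (L : finFieldType) (e : nat) (tau rho : {rmorphism L -> L}) (a b : L).
Hypothesis e_gt0 : (0 < e)%N.
Hypothesis cardL : #|L| = (4 ^ e)%N.
Hypothesis tauE : forall x, tau x = x ^+ 4.
Hypothesis rho_a : rho a = b ^+ 4.
Hypothesis rho_b : rho b = a.
Hypothesis rho_F4 : forall x, x ^+ 4 = x -> rho x = x ^+ 2.

Local Notation "M ^tau" := (map_mx tau M) (at level 2, format "M ^tau").
Local Notation "M ^rho" := (map_mx rho M) (at level 2, format "M ^rho").

Let cardL2 : #|L| = (2 ^ (2 * e))%N.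
Proof. by rewrite cardL expnM. Qed.

Let two0 := two0 cardL2.

(** A projective polynomial: for y != 0, the element x = m y^3 is a root if and
    only if y is a zero of the F_4-linear map
    y |-> m^21 y^64 + a m^5 y^16 + b m y^4 + y. *)
Definition proj_poly (x : L) : L := x ^+ 21 + a * x ^+ 5 + b * x + 1.

(** The matrix A of the recursion attached to proj_poly, acting on row
    vectors by (u, v, w) |-> (v, w, u + b v + a w). *)
Definition companion_entries (i j : nat) : L :=
  nth 0 (nth [::] [:: [:: 0; 0; 1]; [:: 1; 0; b]; [:: 0; 1; a]] i) j.
Definition companion : 'M[L]_3 := \matrix_(i, j) companion_entries i j.

(** The Gram matrix of a sesquilinear form preserved, up to Frobenius, by the
    companion matrix. *)
Definition gauge_entries (i j : nat) : L :=
  nth 0 (nth [::] [:: [:: 0; 0; 1]; [:: 1; 0; 0]; [:: b; 1; 0]] i) j.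
Definition gauge : 'M[L]_3 := \matrix_(i, j) gauge_entries i j.

(** The product A tau(A) ... tau^(k-1)(A). *)
Fixpoint monodromy (k : nat) : 'M[L]_3 :=
  if k is k'.+1 then companion *m (monodromy k')^tau else 1%:M.

Let A := companion.
Let S := gauge.
Let N := monodromy e.

Let AE i j : A i j = companion_entries i j. Proof. by rewrite mxE. Qed.
Let SE i j : S i j = gauge_entries i j. Proof. by rewrite mxE. Qed.

Lemma det_companion : \det A = 1.
Proof. by rewrite (det3 AE) /companion_entries /=; ring. Qed.

Lemma det_gauge : \det S = 1.
Proof. by rewrite (det3 SE) /gauge_entries /=; ring. Qed.

Lemma companion_unit : A \in unitmx.
Proof. by rewrite unitmxE det_companion unitr1. Qed.

Lemma gauge_unit : S \in unitmx.
Proof. by rewrite unitmxE det_gauge unitr1. Qed.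

Lemma det_monodromy k : \det (monodromy k) = 1.
Proof.
elim: k => [|k IHk] /=; first by rewrite det1.
by rewrite det_mulmx det_companion det_map_mx IHk rmorph1 mul1r.
Qed.

Lemma monodromy_unit k : monodromy k \in unitmx.
Proof. by rewrite unitmxE det_monodromy unitr1. Qed.

(** The second exterior power of the recursion with coefficients (a, b) is the
    recursion with coefficients (b^4, a) = (rho a, rho b); the gauge matrix is
    this identification. *)
Lemma companion_gauge : A^rho^T *m S *m A = S^tau.
Proof.
pose c i j := nth 0 (nth [::]
  [:: [:: 1; 0; 0]; [:: b; 1; 0]; [:: a + b ^+ 4 * b; b ^+ 4; 1]] i) j.
have -> : A^rho^T *m S = \matrix_(i, j) c i j.
  apply: (mulmx_eq3 (a := fun i j => rho (companion_entries j i)) (b := gauge_entries)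
     (c := c)) => [i j|i j|i j|]; try by rewrite !mxE.
  move=> [[|[|[|i]]] Hi] [[|[|[|j]]] Hj] //=;
    rewrite /companion_entries /gauge_entries /c /= ?rmorph0 ?rmorph1 ?rho_a ?rho_b; ring.
apply: (mulmx_eq3 (a := c) (b := companion_entries)
     (c := fun i j => tau (gauge_entries i j))) => [i j|i j|i j|]; try by rewrite !mxE.
move=> [[|[|[|i]]] Hi] [[|[|[|j]]] Hj] //=;
  rewrite /companion_entries /gauge_entries /c /= ?rmorph0 ?rmorph1 ?tauE; try ring.
  (* Only the entries that vanish because 2 = 0 remain. *)
  by transitivity (2%:R * b); [ring | rewrite two0 mul0r].
by transitivity (2%:R * (a + b ^+ 5)); [ring | rewrite two0 mul0r].
Qed.

Lemma tau_rhoC (M : 'M[L]_3) : M^tau^rho = M^rho^tau.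
Proof. by apply/matrixP => i j; rewrite !mxE !tauE rmorphXn. Qed.

Lemma monodromy_gauge k : (monodromy k)^rho^T *m S *m monodromy k = iter k (map_mx tau) S.
Proof.
elim: k => [|k IHk] /=; first by rewrite map_mx1 trmx1 mul1mx mulmx1.
rewrite map_mxM trmx_mul -!mulmxA (mulmxA _ S) (mulmxA _ A) companion_gauge.
by rewrite tau_rhoC map_trmx -!map_mxM mulmxA IHk.
Qed.

Lemma iter_map_tau k m n (M : 'M[L]_(m, n)) i j :
  iter k (map_mx tau) M i j = M i j ^+ (4 ^ k).
Proof. by elim: k => //= k IHk; rewrite mxE IHk tauE -exprM -expnSr. Qed.

Lemma iter_map_tau_id m n (M : 'M[L]_(m, n)) : iter e (map_mx tau) M = M.
Proof. by apply/matrixP => i j; rewrite iter_map_tau -cardL expf_card. Qed.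

(** The factors of the monodromy can also be added on the right. *)
Lemma monodromySr k : monodromy k.+1 = monodromy k *m iter k (map_mx tau) A.
Proof.
elim: k => [|k IHk]; first by rewrite /= map_mx1 mulmx1 mul1mx.
by rewrite -[LHS]/(A *m (monodromy k.+1)^tau) {1}IHk map_mxM mulmxA.
Qed.

Lemma monodromy_tau : A *m N^tau = N *m A.
Proof. by have := monodromySr e; rewrite iter_map_tau_id. Qed.

Let t := \tr N.

Lemma mxtrace_map (f : {rmorphism L -> L}) n (M : 'M[L]_n) : \tr (map_mx f M) = f (\tr M).
Proof. by rewrite /mxtrace rmorph_sum; apply: eq_bigr => i _; rewrite mxE. Qed.

Lemma trace_monodromy_F4 : t ^+ 4 = t.
Proof.
rewrite -tauE -mxtrace_map; have -> : N^tau = invmx A *m (N *m A).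
  by rewrite -monodromy_tau mulKmx ?companion_unit.
by rewrite mxtrace_mulC -mulmxA mulmxV ?companion_unit // mulmx1.
Qed.

(** As det N = 1, this is the trace of N^-1, which is conjugate under the gauge
    matrix to the transpose of rho(N). *)
Lemma trace_adj_monodromy : \tr (\adj N) = t ^+ 2.
Proof.
rewrite -(rho_F4 trace_monodromy_F4) -mxtrace_map -[RHS]mxtrace_tr.
have NSN : N^rho^T *m S *m N = S by rewrite monodromy_gauge iter_map_tau_id.
have -> : \adj N = invmx S *m (N^rho^T *m S).
  apply: (can_inj (mulmxK (monodromy_unit e))); rewrite -/N mul_adj_mx det_monodromy.
  by rewrite -mulmxA NSN mulVmx ?gauge_unit.
by rewrite mxtrace_mulC -mulmxA mulmxV ?gauge_unit // mulmx1.
Qed.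

Lemma eigenvalue_monodromy (l : L) :
  eigenvalue N l = (l ^+ 3 + t * l ^+ 2 + t ^+ 2 * l + 1 == 0).
Proof.
rewrite -trace_adj_monodromy -[X in _ + X](det_monodromy e) -det3_add_scalar.
have sE : N - l%:M = l%:M + N.
  by rewrite addrC; congr (_ + _); apply/matrixP => i j; rewrite !mxE (oppxx cardL2).
apply/eigenvalueP/det0P => [[v vN v0] | [v v0 vN]]; exists v => //.
  by rewrite -sE mulmxBr vN mul_mx_scalar subrr.
by apply/subr0_eq; rewrite -vN -sE mulmxBr mul_mx_scalar.
Qed.

(** The row vector (1, x, x^5). *)
Definition root_vec (x : L) : 'rV[L]_3 := \row_j nth 0 [:: 1; x; x ^+ 5] j.

Lemma root_vec_companion x : proj_poly x = 0 -> root_vec x *m A = x *: (root_vec x)^tau.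
Proof.
move=> x0; apply/matrixP => i [[|[|[|j]]] Hj] //=;
 rewrite !mxE !big_ord_recl big_ord0 !mxE /companion_entries /= ?rmorph1 ?tauE; try ring.
apply/subr0_eq; transitivity (- proj_poly x + 2%:R * (1 + a * x ^+ 5 + b * x)).
  by rewrite /proj_poly; ring.
by rewrite x0 two0 mul0r oppr0 addr0.
Qed.

Lemma root_vec_monodromy x : proj_poly x = 0 -> root_vec x *m N = x ^+ geom4 e *: root_vec x.
Proof.
move=> x0; rewrite -[X in _ = _ *: X]iter_map_tau_id /N; elim: (e) => [|k IHk] /=.
  by rewrite mulmx1 scale1r.
rewrite mulmxA root_vec_companion // -scalemxAl -map_mxM IHk map_mxZ scalerA tauE.
by rewrite -exprM -exprS mulnC.
Qed.

Lemma root_vec_neq0 x : root_vec x != 0.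
Proof.
apply: contraTneq isT => /matrixP /(_ 0 0); rewrite !mxE /= => /eqP.
by rewrite oner_eq0.
Qed.

Lemma eigenvalue_root x : proj_poly x = 0 -> eigenvalue N (x ^+ geom4 e).
Proof.
by move=> x0; apply/eigenvalueP; exists (root_vec x); rewrite ?root_vec_monodromy ?root_vec_neq0.
Qed.

(** Hilbert 90 for the operator u |-> mu tau(u) A^-1: on the eigenspace of N for
    mu^((4^e-1)/3) its e-th power is the identity, so summing over the iterates
    of z v gives fixed vectors, nonzero for some scalar z.  A nonzero fixed
    vector (w0, w1, w2) is proportional to (1, x, x^5) with x = mu w0^3 a root. *)
Lemma root_of_eigenvalue mu :
  mu != 0 -> eigenvalue N (mu ^+ geom4 e) ->
  exists2 x, proj_poly x = 0 & x ^+ geom4 e = mu ^+ geom4 e.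
Proof.
move=> mu0 /eigenvalueP[v vN v0].
(* T k z is the k-th iterate of u |-> mu tau(u) A^-1 at z v. *)
pose T (k : nat) z :=
  (mu ^+ geom4 k * z ^+ (4 ^ k)) *: (iter k (map_mx tau) v *m invmx (monodromy k)).
have TN k z : T k z *m monodromy k = (mu ^+ geom4 k * z ^+ (4 ^ k)) *: iter k (map_mx tau) v.
  by rewrite /T -scalemxAl mulmxKV ?monodromy_unit.
have TS k z : T k.+1 z *m A = mu *: (T k z)^tau.
  suff -> : T k.+1 z = mu *: (T k z)^tau *m invmx A by rewrite mulmxKV ?companion_unit.
  apply: (can_inj (mulmxK (monodromy_unit k.+1))); rewrite TN /= mulmxA.
  rewrite mulmxKV ?companion_unit // -scalemxAl -map_mxM TN map_mxZ scalerA.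
  by rewrite rmorphM !tauE -!exprM -expnSr mulrA -exprS mulnC.
have Te z : T e z = T 0%N z.
  apply: (can_inj (mulmxK (monodromy_unit e))); rewrite TN iter_map_tau_id -cardL expf_card.
  rewrite /T -[invmx _]/(invmx 1%:M) invmx1 mulmx1 -scalemxAl -/N vN scalerA.
  by rewrite !expr1 mul1r mulrC.
pose w z := \sum_(k < e) T k z.
have wT z : w z *m A = mu *: (w z)^tau.
  rewrite /w mulmx_suml map_mx_sum scaler_sumr.
  rewrite -(big_mkord xpredT (fun k => T k z *m A)).
  rewrite -(big_mkord xpredT (fun k => mu *: (T k z)^tau)).
  case: (e) e_gt0 Te => // e' _ Te'; rewrite big_nat_recl //= big_nat_recr //= -Te' addrC.
  by rewrite -TS; congr (_ + _); apply: eq_bigr => k _; rewrite TS.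
have [z wz0] : exists z, w z != 0.
  have [j vj] : exists j, v 0 j != 0.
    by apply/existsP; apply: contraNT v0; rewrite negb_exists => /forallP v0;
      apply/eqP/matrixP => i j; rewrite ord1 mxE; apply/eqP; rewrite -[_ == _]negbK v0.
  pose c k := mu ^+ geom4 k * (iter k (map_mx tau) v *m invmx (monodromy k)) 0 j.
  have c0 : c 0%N != 0 by rewrite /c /= mul1r invmx1 mulmx1.
  have [z] := additive_poly_nonzero (isT : (1 < 4)%N) e_gt0 cardL c0.
  have -> : \sum_(k < e) c k * z ^+ (4 ^ k) = w z 0 j.
    by rewrite /w summxE; apply: eq_bigr => k _; rewrite /T mxE /c mulrAC.
  by move=> wj; exists z; apply: contraNneq wj => ->; rewrite mxE.
have [w0 [w1 [w2 wE]]] : exists w0 w1 w2, forall j, w z 0 j = nth 0 [:: w0; w1; w2] j.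
  exists (w z 0 (inord 0)), (w z 0 (inord 1)), (w z 0 (inord 2)) => -[[|[|[|j]]] Hj] //=;
   by congr (w z 0 _); apply: val_inj; rewrite /= inordK.
have wA (j : 'I_3) : w0 * companion_entries 0 j + w1 * companion_entries 1 j
    + w2 * companion_entries 2 j = mu * nth 0 [:: w0; w1; w2] j ^+ 4.
  have /matrixP /(_ 0 j) := wT z; rewrite !mxE !big_ord_recl big_ord0 !mxE !wE /= tauE => <-.
  by rewrite addr0 addrA.
have := wA (Ordinal (isT : (0 < 3)%N)); have := wA (Ordinal (isT : (1 < 3)%N)).
have := wA (Ordinal (isT : (2 < 3)%N)).
rewrite /companion_entries /= !mulr0 !mulr1 !add0r !addr0 => w2E w1E w0E.
have w00 : w0 != 0.
  apply: contraNneq wz0 => w00; apply/eqP/matrixP => i j; rewrite ord1 wE mxE.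
  have w10 : w1 = 0 by rewrite w0E w00 expr0n mulr0.
  have w20 : w2 = 0 by rewrite w1E w10 expr0n mulr0.
  by rewrite w00 w10 w20; case: j => [[|[|[|j]]] Hj].
exists (mu * w0 ^+ 3); last first.
  rewrite exprMn -exprM; suff -> : w0 ^+ (3 * geom4 e) = 1 by rewrite mulr1.
  by apply: (mulfI w00); rewrite -exprS geom4E -cardL expf_card mulr1.
apply: (mulfI w00); rewrite mulr0 /proj_poly.
transitivity (w0 + w1 * b + w2 * a - mu * w2 ^+ 4 + 2%:R * (mu * w2 ^+ 4)).
  by rewrite w1E w0E; ring.
by rewrite w2E two0 mul0r addr0 subrr.
Qed.

Variables (om g : L).
Hypothesis om_prim : 3.-primitive_root om.
Hypothesis g_om : g ^+ geom4 e = om.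

(** The roots whose cubic residue symbol is om^i, that is, which lie in the cube
    class of g^i. *)
Definition class_roots (i : nat) : {set L} :=
  [set x | (proj_poly x == 0) && (x ^+ geom4 e == om ^+ i)].

Let om_exp_eq (i j : 'I_3) : (om ^+ i == om ^+ j) = (i == j).
Proof. by rewrite (eq_prim_root_expr om_prim) !modn_small. Qed.

Let g_neq0 : g != 0.
Proof.
apply/eqP => g0; have := prim_expr_order om_prim; rewrite -g_om g0 -exprM expr0n.
have -> : ((geom4 e * 3)%N == 0%N) = false by case: (e) e_gt0.
by move/eqP; rewrite eq_sym oner_eq0.
Qed.

Lemma card_class_roots_le i : (#|class_roots i| <= 21)%N.
Proof.
pose P : {poly L} := 'X^21 + (a *: 'X^5 + b *: 'X + 1).
have szP : size P = 22%N.
  rewrite size_polyDl size_polyXn //.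
  apply: (leq_ltn_trans (size_polyD _ _)); rewrite size_poly1 gtn_max andbT.
  apply: (leq_ltn_trans (size_polyD _ _)); rewrite gtn_max.
  by rewrite !(leq_ltn_trans (size_scale_leq _ _)) ?size_polyXn ?size_polyX.
have Pn0 : P != 0 by rewrite -size_poly_eq0 szP.
have := max_poly_roots Pn0 (rs := enum (class_roots i)).
rewrite szP -cardE enum_uniq ltnS => -> //.
apply/allP => x; rewrite mem_enum inE => /andP[/eqP x0 _].
rewrite /root; have -> : P.[x] = proj_poly x; last by rewrite x0.
by rewrite /P /proj_poly !hornerD !hornerZ !hornerXn hornerX hornerC; ring.
Qed.

Lemma class_roots_neq0 i : eigenvalue N (om ^+ i) -> (0 < #|class_roots i|)%N.
Proof.
have <- : (g ^+ i) ^+ geom4 e = om ^+ i by rewrite -exprM mulnC exprM g_om.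
case/(root_of_eigenvalue (expf_neq0 i g_neq0)) => x x0 xi.
by apply/card_gt0P; exists x; rewrite inE x0 xi -exprM mulnC exprM g_om !eqxx.
Qed.

Lemma class_roots_eigenvalue i x : x \in class_roots i -> eigenvalue N (om ^+ i).
Proof. by rewrite inE => /andP[/eqP x0 /eqP <-]; apply: eigenvalue_root. Qed.

(** The second case is that of trace 0, when the monodromy has the three cube
    roots of unity as simple eigenvalues; otherwise it has a single eigenvalue,
    its trace. *)
Lemma class_roots_dichotomy :
     (exists2 i0 : 'I_3, (0 < #|class_roots i0|)%N
        & forall i : 'I_3, i != i0 -> #|class_roots i| = 0%N)
  \/ (forall i : 'I_3, #|class_roots i| = 1%N).
Proof.
have om3 i : (om ^+ i) ^+ 3 = 1 by rewrite -exprM mulnC exprM (prim_expr_order om_prim) expr1n.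
have [t0|tn0] := eqVneq t 0; [right | left].
  have ev i : eigenvalue N (om ^+ i).
    by rewrite eigenvalue_monodromy t0 om3 expr0n !mul0r !addr0 (addxx cardL2).
  have rk1 (i : 'I_3) : \rank (eigenspace N (om ^+ i)) = 1%N.
    have rk_gt0 (j : 'I_3) : (0 < \rank (eigenspace N (om ^+ j)))%N.
      by rewrite lt0n mxrank_eq0 -/(eigenvalue _ _) ev.
    have inj_om : {in xpredT &, injective (fun j : 'I_3 => om ^+ j)}.
      by move=> j k _ _ /eqP; rewrite om_exp_eq => /eqP.
    have /mxdirectP /= rkE := mxdirect_sum_eigenspace N inj_om.
    have := rank_leq_row (\sum_(j < 3) eigenspace N (om ^+ j))%MS.
    rewrite rkE (bigD1 i) //= => le3.
    have : (\sum_(j < 3 | j != i) 1 <= \sum_(j < 3 | j != i) \rank (eigenspace N (om ^+ j)))%N.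
      by apply: leq_sum.
    rewrite sum1_card cardC1 card_ord; have := rk_gt0 i; move=> h1 h2; apply/eqP.
    by rewrite eqn_leq h1 andbT -(leq_add2r 2); apply: leq_trans le3; rewrite leq_add2l.
  (* Two roots of one class give vectors of the same line with first entry 1. *)
  move=> i; apply/eqP; rewrite eqn_leq class_roots_neq0 // andbT.
  apply/card_le1_eqP => x y; rewrite !inE => /andP[/eqP x0 /eqP xi] /andP[/eqP y0 /eqP yi].
  have sub z : proj_poly z = 0 -> z ^+ geom4 e = om ^+ i ->
      (root_vec z <= eigenspace N (om ^+ i))%MS.
    by move=> z0 zi; apply/eigenspaceP; rewrite root_vec_monodromy // zi.
  have : (root_vec y <= root_vec x)%MS.
    apply: submx_trans (sub y y0 yi) _.
    by rewrite -(geq_leqif (mxrank_leqif_sup (sub x x0 xi))) rk1 rank_rV root_vec_neq0.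
  case/sub_rVP => k yE; have := congr1 (fun M : 'rV_3 => M 0 (inord 0)) yE.
  have := congr1 (fun M : 'rV_3 => M 0 (inord 1)) yE.
  by rewrite !mxE !inordK //= mulr1 => -> <-; rewrite mul1r.
have t3 : t ^+ 3 = 1 by apply: (mulfI tn0); rewrite -exprS trace_monodromy_F4 mulr1.
have [i0 ti0] := prim_rootP om_prim t3.
have ev (i : 'I_3) : eigenvalue N (om ^+ i) = (i == i0).
  rewrite eigenvalue_monodromy om3 -om_exp_eq -ti0.
  have -> : 1 + t * om ^+ i ^+ 2 + t ^+ 2 * om ^+ i + 1
      = t * om ^+ i * (om ^+ i - t) + 2%:R * (1 + t ^+ 2 * om ^+ i) by ring.
  rewrite two0 mul0r addr0 !mulf_eq0 (negPf tn0) expf_eq0 subr_eq0 /=.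
  have : om != 0
    by rewrite -g_om expf_neq0.
  by move/negPf ->; rewrite andbF.
exists i0; first by rewrite class_roots_neq0 // ev.
move=> i ii0; apply: eq_card0 => x; apply/negP => /class_roots_eigenvalue.
by rewrite ev (negPf ii0).
Qed.

End Monodromy.

(** * Power maps and cubic residue classes *)

Lemma pow2_rmorphism (L : finFieldType) n (cardL : #|L| = (2 ^ n)%N) k :
  exists f : {rmorphism L -> L}, forall x, f x = x ^+ (2 ^ k).
Proof.
elim: k => [|k [f fE]]; first by exists (idfun : {rmorphism L -> L}) => x; rewrite expr1.
exists (pFrobenius_aut (pchar_two cardL) \o f : {rmorphism L -> L}) => x.
by rewrite /= pFrobenius_autE fE -exprM -expnSr.
Qed.

Section Classes.

Variables (L : finFieldType) (e : nat) (om g : L).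
Hypothesis cardL : #|L| = (4 ^ e)%N.
Hypothesis om_prim : 3.-primitive_root om.
Hypothesis g_om : g ^+ geom4 e = om.

Let om3 : om ^+ 3 = 1 := prim_expr_order om_prim.

Lemma prim3_neq0 : om != 0.
Proof. by rewrite (prim_root_eq0 om_prim). Qed.

Lemma expf_geom4 (y : L) : y != 0 -> y ^+ (3 * geom4 e) = 1.
Proof. by move=> y0; apply: (mulfI y0); rewrite -exprS geom4E -cardL expf_card mulr1. Qed.

(** A power map y |-> y^k of the multiplicative group with kernel of order 3,
    such as the cube or y |-> y^2 bar y. *)
Section Power.

Variable k : nat.
Hypothesis k3 : forall v : L, (v ^+ k == 1) = (v ^+ 3 == 1).

Lemma power_fiber (y0 : L) : y0 != 0 ->
  [set y | y ^+ k == y0 ^+ k] = [set om ^+ i * y0 | i : 'I_3].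
Proof.
move=> y00; apply/setP => y; rewrite inE; apply/idP/imsetP => [/eqP yk | [i _ ->]].
  have /eqP y3 : (y / y0) ^+ 3 == 1.
    by rewrite -k3 exprMn exprVn yk divff // expf_neq0.
  have [i yi] := prim_rootP om_prim y3.
  by exists i => //; rewrite -yi mulfVK.
have /eqP : om ^+ k == 1 by rewrite k3 om3.
by rewrite exprMn -exprM mulnC exprM => ->; rewrite expr1n mul1r.
Qed.

Lemma om_orbit_inj (y0 : L) : y0 != 0 -> injective (fun i : 'I_3 => om ^+ i * y0).
Proof.
move=> y00 i j /(mulIf y00) /eqP.
by rewrite (eq_prim_root_expr om_prim) !modn_small // => /eqP /val_inj.
Qed.

Lemma card_power_fiber (y0 : L) : y0 != 0 -> #|[set y | y ^+ k == y0 ^+ k]| = 3%N.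
Proof. by move=> y00; rewrite power_fiber // card_imset ?card_ord //; apply: om_orbit_inj. Qed.

Lemma g_neq0 : g != 0.
Proof.
apply/eqP => g0; move: g_om; rewrite g0 expr0n; case: eqP => _ omE.
  by have := prim_order_dvd om_prim 1; rewrite expr1 -omE eqxx.
by move/eqP: omE; rewrite eq_sym (negPf prim3_neq0).
Qed.

(** Every nonzero element is g^i y^k for exactly three pairs (i, y). *)
Lemma sum_classes (f : L -> int) :
  \sum_(i < 3) \sum_(y | y != 0) f (g ^+ i * y ^+ k) = 3%:R * \sum_(x | x != 0) f x.
Proof.
have k_3 : (3 %| k)%N.
  by rewrite (prim_order_dvd om_prim) k3 om3.
pose F (p : 'I_3 * L) := g ^+ p.1 * p.2 ^+ k.
have F0 p : p.2 != 0 -> F p != 0 by move=> p0; rewrite mulf_neq0 ?expf_neq0 ?g_neq0.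
have Fm p : p.2 != 0 -> F p ^+ geom4 e = om ^+ p.1.
  move=> p0; rewrite exprMn -exprM mulnC exprM g_om -exprM.
  have /dvdnP[k' ->] := k_3; rewrite -mulnA mulnC exprM (expf_geom4 p0) expr1n mulr1 //.
pose fib x := [set p | (p.2 != 0) && (F p == x)].
have fib_le x : (#|fib x| <= 3)%N.
  have [-> | [p0]] := set_0Vmem (fib x); first by rewrite cards0.
  rewrite inE => /andP[p00 /eqP Fp0].
  apply: (@leq_trans #|[set (p0.1, y) | y in [set y | y ^+ k == p0.2 ^+ k]]|); last first.
    by rewrite card_imset ?card_power_fiber // => y y' [].
  apply/subset_leq_card/subsetP => p; rewrite inE => /andP[pn0 /eqP Fp].
  have p1 : p.1 = p0.1.
    apply/val_inj/eqP; have /eqP := Fm p pn0; rewrite Fp -Fp0 Fm //.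
    by rewrite (eq_prim_root_expr om_prim) !modn_small // eq_sym.
  apply/imsetP; exists p.2; last by rewrite -p1; case: (p).
  by rewrite inE; move: Fp; rewrite -Fp0 /F p1 => /(mulfI (expf_neq0 _ g_neq0)) ->.
(* There are 3 (#|L| - 1) pairs and #|L| - 1 fibers, each of at most 3 pairs. *)
have sum_fib : (\sum_(x : L | x != 0%R) #|fib x| = \sum_(x : L | x != 0%R) 3)%N.
  rewrite sum_nat_const.
  transitivity (\sum_(p : 'I_3 * L | p.2 != 0%R) 1)%N.
    rewrite (partition_big F [pred x | x != 0]) //=.
    by apply: eq_bigr => x x0; rewrite -sum1_card; apply: eq_bigl => p; rewrite inE.
  rewrite -(pair_big xpredT (fun y : L => y != 0) (fun _ _ => 1%N)) /= sum_nat_const card_ord.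
  by rewrite sum1_card mulnC.
have fib3 x : x != 0 -> #|fib x| = 3%N.
  have := leqif_sum (fun x (_ : x != 0) => leqif_eq (fib_le x)).
  rewrite sum_fib => -[_]; rewrite eqxx => /esym /forall_inP h x0.
  by apply/eqP; apply: h.
rewrite pair_big /= (partition_big F [pred x | x != 0]) //=.
rewrite mulr_sumr; apply: eq_bigr => x x0.
rewrite (eq_bigr (fun=> f x)) => [|p /andP[_ /eqP <-] //].
rewrite (eq_bigl [in fib x]) => [|p]; last by rewrite inE.
by rewrite sumr_const fib3 // mulr_natl.
Qed.

End Power.

(** The nonzero elements form orbits of length 3 under multiplication by om. *)
Lemma sum_om_invariant (f : L -> int) :
  (forall y, f (om * y) = f y) -> exists s : int, \sum_(y | y != 0) f y = 3%:R * s.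
Proof.
have cube (v : L) : (v ^+ 3 == 1) = (v ^+ 3 == 1) by [].
move=> fom; have fomX i y : f (om ^+ i * y) = f y.
  by elim: i => [|i IHi]; rewrite ?mul1r // exprS -mulrA fom.
rewrite (partition_big (fun y => y ^+ 3) xpredT) //=.
suff /fin_all_exists[s sE] : forall x, exists s : int,
    \sum_(y | (y != 0) && (y ^+ 3 == x)) f y = 3%:R * s.
  by exists (\sum_x s x); rewrite mulr_sumr; apply: eq_bigr.
move=> x; case: (pickP [pred y | (y != 0) && (y ^+ 3 == x)]) => [y0 /= /andP[y00 /eqP <-] | none].
  exists (f y0); rewrite (eq_bigl [in [set y | y ^+ 3 == y0 ^+ 3]]) => [|y]; last first.
    rewrite inE; case: (y ^+ 3 =P y0 ^+ 3) => [/eqP yk|]; rewrite ?andbF // andbT.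
    have : y \in [set y | y ^+ 3 == y0 ^+ 3] by rewrite inE.
    rewrite (power_fiber cube) // => /imsetP[i _ ->].
    by rewrite mulf_neq0 ?expf_neq0 ?prim3_neq0.
  rewrite (power_fiber cube) // big_imset /=; last by move=> i j _ _; apply: om_orbit_inj.
  by under eq_bigr => i _ do rewrite fomX; rewrite sumr_const card_ord mulr_natl.
by exists 0; rewrite mulr0 big_pred0.
Qed.


End Classes.

(** * Hermitian exponential sums *)

Section Sums.

Variables (L : finFieldType) (e : nat) (om g : L).
Let q := (2 ^ e)%N.
Hypothesis e_gt0 : (0 < e)%N.
Hypothesis e_even : ~~ odd e.
Hypothesis cardL : #|L| = (q ^ 2)%N.
Hypothesis om_prim : 3.-primitive_root om.
Hypothesis g_om : g ^+ geom4 e = om.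
Hypothesis g_bar : g ^+ q = g.

(** Conjugation over the subfield of order q; it is an involution of L. *)
Definition qconj (x : L) : L := x ^+ q.
Local Notation bar := qconj.

Let cardL2 : #|L| = (2 ^ (e * 2))%N.
Proof. by rewrite cardL expnM. Qed.

Let cardL4 : #|L| = (4 ^ e)%N.
Proof. by rewrite cardL2 mulnC expnM. Qed.

Let two0 := two0 cardL2.
Let chiD := chiD cardL2.

Lemma modn_q3 : (q = 1 %[mod 3])%N.
Proof.
by rewrite /q -(odd_double_half e) (negbTE e_even) add0n -mul2n expnM -modnXm exp1n.
Qed.

Lemma q_gt0 : (0 < q)%N. Proof. by rewrite expn_gt0. Qed.

Lemma barD x y : bar (x + y) = bar x + bar y.
Proof. exact: exprD_pow2 cardL2 _ _ _. Qed.

Lemma barM x y : bar (x * y) = bar x * bar y.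
Proof. exact: exprMn. Qed.

Lemma barX x n : bar (x ^+ n) = bar x ^+ n.
Proof. by rewrite /bar -!exprM mulnC. Qed.

Lemma barK : involutive bar.
Proof. by move=> x; rewrite /bar -exprM -[RHS]expf_card cardL. Qed.

Lemma bar0 : bar 0 = 0.
Proof. by rewrite /bar expr0n gtn_eqF ?q_gt0. Qed.

Lemma bar_eq0 x : (bar x == 0) = (x == 0).
Proof. by rewrite -(inj_eq (inv_inj barK)) bar0 barK. Qed.

Lemma om3 : om ^+ 3 = 1. Proof. exact: prim_expr_order. Qed.

Lemma om_bar : bar om = om.
Proof. by rewrite /bar -(prim_expr_mod om_prim) modn_q3 expr1. Qed.

Lemma om_rel : om ^+ 2 + om + 1 = 0.
Proof.
apply: (mulfI (_ : om - 1 != 0)).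
  rewrite subr_eq0; have := prim_order_dvd om_prim 1; rewrite expr1 => <- //.
by rewrite mulr0; transitivity (om ^+ 3 - 1); [ring | rewrite om3 subrr].
Qed.

Lemma chi_bar (x : L) : chi (bar x) = chi x.
Proof. exact: chi_pow2 cardL2 _ _. Qed.

Lemma chi_exp8 (x : L) : chi (x ^+ 8) = chi x.
Proof. exact: (chi_pow2 cardL2 3). Qed.

Section Form.

Variables c gam : L.
Hypothesis c_bar : bar c = c.

(** The trace of this expression is a quadratic form over F_2 and, being
    invariant under multiplication of y by om, the restriction to the diagonal
    of a Hermitian form over F_4. *)
Definition herm (y : L) : L := c ^+ 3 * y ^+ 8 * bar y + gam * c * y ^+ 2 * bar y.

Definition herm_sum : int := \sum_y chi (herm y).

(** The polar form of Tr(herm y) is Tr(y^8 rad_op z), obtained by moving each of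
    its four terms to a multiple of y^8 by conjugation and Frobenius. *)
Definition rad_op (z : L) : L :=
  c ^+ 24 * bar z ^+ 64 + (bar gam * c * bar z ^+ 2) ^+ 8 + (gam * c * bar z) ^+ 4
  + c ^+ 3 * bar z.

Definition radical : {set L} := [set z | rad_op z == 0].

Lemma herm_polar y z : chi (herm (y + z)) = chi (herm y) * chi (herm z) * chi (y ^+ 8 * rad_op z).
Proof.
pose u1 := c ^+ 3 * y ^+ 8 * bar z; pose u2 := c ^+ 3 * z ^+ 8 * bar y.
pose u3 := gam * c * y ^+ 2 * bar z; pose u4 := gam * c * z ^+ 2 * bar y.
have -> : herm (y + z) = herm y + herm z + (u1 + u2 + u3 + u4).
  have D8 : (y + z) ^+ 8 = y ^+ 8 + z ^+ 8 by exact: (exprD_pow2 cardL2 3).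
  have D2 : (y + z) ^+ 2 = y ^+ 2 + z ^+ 2 by exact: (exprD_pow2 cardL2 1).
  by rewrite /herm D8 D2 barD /u1 /u2 /u3 /u4; ring.
rewrite 2!chiD; congr (_ * _); rewrite !chiD.
rewrite -(chi_exp8 u2) -(chi_bar (u2 ^+ 8)) -(chi_bar u4) -(chi_exp8 (bar u4)).
have -> : bar (u2 ^+ 8) = y ^+ 8 * (c ^+ 24 * bar z ^+ 64).
  have -> : bar (u2 ^+ 8) = (bar (c ^+ 3) * bar (z ^+ 8) * bar (bar y)) ^+ 8 by rewrite barX -!barM.
  by rewrite barK (barX c) (barX z) c_bar; ring.
have -> : chi u3 = chi (y ^+ 8 * (gam * c * bar z) ^+ 4).
  by rewrite -(chi_pow2 cardL2 2) /u3; congr (chi _); rewrite -[(2 ^ 2)%N]/4%N; ring.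
have -> : bar u4 ^+ 8 = y ^+ 8 * (bar gam * c * bar z ^+ 2) ^+ 8.
  have -> : bar u4 = bar gam * bar c * bar (z ^+ 2) * bar (bar y) by rewrite -!barM.
  by rewrite barK (barX z) c_bar; ring.
rewrite -!chiD; congr (chi _); rewrite /u1 /rad_op; ring.
Qed.

Lemma herm_om y : herm (om * y) = herm y.
Proof.
rewrite /herm barM om_bar.
transitivity ((om ^+ 3) ^+ 3 * (c ^+ 3 * y ^+ 8 * bar y) + om ^+ 3 * (gam * c * y ^+ 2 * bar y)).
  ring.
by rewrite om3 expr1n !mul1r.
Qed.

Lemma rad_op_om z : rad_op (om * z) = om * rad_op z.
Proof.
rewrite /rad_op barM om_bar.
transitivity (om * ((om ^+ 3) ^+ 21 * (c ^+ 24 * bar z ^+ 64) 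
  + (om ^+ 3) ^+ 5 * (bar gam * c * bar z ^+ 2) ^+ 8 + om ^+ 3 * (gam * c * bar z) ^+ 4
  + c ^+ 3 * bar z)).
  ring.
by rewrite om3 !expr1n !mul1r.
Qed.

(** The quadratic form is additive on its radical and takes the same value at z,
    om z and om^2 z = z + om z. *)
Lemma herm_radical z : z \in radical -> chi (herm z) = 1.
Proof.
rewrite inE => /eqP z0.
have := herm_polar z (om * z).
rewrite rad_op_om z0 !mulr0 (chi0 cardL2) mulr1 herm_om (chi_chi cardL2) => <-.
have -> : z + om * z = om * (om * z).
  transitivity (om * (om * z) + (om ^+ 2 + om + 1) * z + 2%:R * (- om ^+ 2 * z)); first by ring.
  by rewrite om_rel two0 !mul0r !addr0.
by rewrite !herm_om.
Qed.

Lemma herm_sum_sqr : herm_sum ^+ 2 = (q ^ 2)%:R * #|radical|%:R.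
Proof.
rewrite expr2 {1}/herm_sum mulr_suml.
have -> : \sum_y chi (herm y) * herm_sum
   = \sum_y \sum_z chi (herm z) * chi (rad_op z * y ^+ 8).
  apply: eq_bigr => y _; rewrite /herm_sum (reindex_inj (addrI y)) /= mulr_sumr.
  apply: eq_bigr => z _; rewrite herm_polar [y ^+ 8 * _]mulrC -(mulrA (chi (herm y))) mulrA.
  by rewrite (chi_chi cardL2) mul1r.
rewrite exchange_big /= (bigID [in radical]) /= [X in _ + X]big1 ?addr0 => [|z zR].
  rewrite (eq_bigr (fun=> (q ^ 2)%:R)) => [|z zR]; first by rewrite sumr_const mulr_natr.
  move: (zR); rewrite inE => /eqP ->.
  under eq_bigr => y _ do rewrite herm_radical // mul0r (chi0 cardL2).
  by rewrite sumr_const cardL mulr1.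
rewrite -mulr_sumr.
have inj8 : injective (fun y : L => y ^+ 8).
  move=> y y' /eqP; rewrite -subr_eq0 (oppxx cardL2) -(exprD_pow2 cardL2 3) expf_eq0 /=.
  by rewrite addr_eq0 (oppxx cardL2) => /eqP.
have := sum_chiM cardL2 (rad_op z); rewrite (reindex_inj inj8) /= => ->.
by move: zR; rewrite inE => /negPf ->; rewrite mulr0.
Qed.


Lemma herm0 : herm 0 = 0.
Proof. by rewrite /herm !expr0n /= !mulr0 !mul0r addr0. Qed.

Lemma herm_sum_mod3 : exists s : int, herm_sum = 1 + 3%:R * s.
Proof.
have [s sE] := sum_om_invariant om_prim (f := fun y => chi (herm y))
  (fun y => congr1 (@chi L) (herm_om y)).
exists s; rewrite -sE /herm_sum (bigID (pred1 0)) /= big_pred1_eq herm0 (chi0 cardL2) //.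
Qed.

Lemma rad_opE z : rad_op z = c ^+ 3 * bar z * proj_poly (bar gam ^+ 8) (gam ^+ 4) (c * bar z ^+ 3).
Proof. rewrite /rad_op /proj_poly; ring. Qed.

Lemma rad_opD y z : rad_op (y + z) = rad_op y + rad_op z.
Proof.
rewrite /rad_op barD.
have D k (u v : L) : (u + v) ^+ (2 ^ k) = u ^+ (2 ^ k) + v ^+ (2 ^ k) by exact: exprD_pow2 cardL2 _ _ _.
rewrite (D 6) (D 1%N) (mulrDr (bar gam * c)) (D 3) (mulrDr (gam * c)) (D 2) /=; ring.
Qed.

Lemma card_radical_dvd : (#|radical| %| 2 ^ (e * 2))%N.
Proof.
have grpR : group_set radical.
  apply/group_setP; split=> [|y z]; rewrite !inE.
    by rewrite rad_opE bar0 mulr0 mul0r.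
  by move=> /eqP y0 /eqP z0; rewrite rad_opD y0 z0 addr0.
by rewrite -cardL2 -cardsT; have := cardSg (subsetT (Group grpR)).
Qed.

End Form.

Section ClassSums.

Variable gam : L.

Let Q (i : nat) := herm_sum (g ^+ i) gam.
Let R (i : nat) := class_roots e (bar gam ^+ 8) (gam ^+ 4) om i.

Let gX_bar i : bar (g ^+ i) = g ^+ i.
Proof. by rewrite barX /bar g_bar. Qed.

Let gXm j : (g ^+ j) ^+ geom4 e = om ^+ j.
Proof. by rewrite -exprM mulnC exprM g_om. Qed.

(** The map z |-> g^i (bar z)^3 is three to one from the nonzero elements of the
    radical onto the roots of the class of g^i. *)
Lemma card_radical (i : 'I_3) : #|radical (g ^+ i) gam| = (1 + 3 * #|R i|)%N.
Proof.
have g0 : g != 0 := g_neq0 om_prim g_om.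
apply/eqP; rewrite -(@eqr_nat int) natrD natrM; apply/eqP.
have f0 x : (x \in R i) -> x != 0.
  rewrite inE => /andP[/eqP x0 _]; apply: contra_eq_neq x0 => ->.
  by rewrite /proj_poly !expr0n /= !mulr0 !add0r oner_eq0.
have := sum_classes cardL4 om_prim g_om (k := 3) (fun v => erefl) (fun x => (x \in R i)%:R : int).
have -> : \sum_(x : L | x != 0%R) (x \in R i)%:R = #|R i|%:R :> int.
  rewrite -sum1_card natr_sum [RHS]big_mkcond [LHS]big_mkcond; apply: eq_bigr => x _.
  by case: (boolP (x \in R i)) => [/f0 ->|]; rewrite ?if_same.
move=> <-; rewrite (bigD1 i) //= [X in _ + (_ + X)]big1 ?addr0 => [|j ji]; last first.
  apply: big1 => y y0; rewrite inE exprMn -[(y ^+ 3) ^+ _]exprM (expf_geom4 cardL4 y0) mulr1.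
  rewrite gXm (eq_prim_root_expr om_prim) !modn_small //.
  by rewrite val_eqE (negPf ji) andbF.
rewrite -sum1_card natr_sum (bigD1 0) /=; last by rewrite inE rad_opE bar0 mulr0 mul0r.
congr (_ + _); rewrite (reindex_inj (inv_inj barK)) /= big_mkcond [RHS]big_mkcond.
apply: eq_bigr => y _; rewrite bar_eq0 !inE rad_opE barK.
have [->|y0] := eqVneq y 0; first by rewrite andbF.
rewrite !mulf_eq0 (negPf (expf_neq0 i g0)) (negPf y0) /= andbT.
rewrite exprMn -[(y ^+ 3) ^+ _]exprM (expf_geom4 cardL4 y0) mulr1.
by rewrite gXm eqxx andbT; case: (_ == 0).
Qed.


(** The radical has order a power of 2 that is 1 mod 3 and at most 1 + 3 * 21; the
    sign of the sum is determined modulo 3. *)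
Lemma herm_sum_cases (i : 'I_3) :
     (#|R i| = 0%N /\ Q i = q%:R)
  \/ (#|R i| = 1%N /\ Q i = - (2%:R * q%:R))
  \/ (#|R i| = 5%N /\ Q i = 4%:R * q%:R)
  \/ (#|R i| = 21%N /\ Q i = - (8%:R * q%:R)).
Proof.
have Rle : (#|R i| <= 21)%N by exact: card_class_roots_le.
have cR := card_radical i.
have Qsqr : Q i ^+ 2 = (q ^ 2)%:R * #|radical (g ^+ i) gam|%:R by apply: herm_sum_sqr; apply: gX_bar.
have [s sE] : exists s : int, Q i = 1 + 3%:R * s by apply: herm_sum_mod3.
have [u uE] : exists u : nat, q = (3 * u).+1.
  by exists (q %/ 3)%N; rewrite {1}(divn_eq q 3) modn_q3 //; lia.
have Qpm (k : nat) : #|radical (g ^+ i) gam| = (k ^ 2)%N ->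
    Q i = k%:R * q%:R \/ Q i = - (k%:R * q%:R).
  move=> Rk; have /eqP : Q i ^+ 2 = (k%:R * q%:R) ^+ 2.
    by rewrite Qsqr Rk !natrX exprMn mulrC.
  by rewrite eqf_sqr => /orP[] /eqP ->; [left | right].
have /(dvdn_pfactor _ _ (isT : prime 2))[j _ jE] : (#|radical (g ^+ i) gam| %| 2 ^ (e * 2))%N.
  by apply: card_radical_dvd.
have : (2 ^ j <= 2 ^ 6)%N by rewrite -jE cR -[(2 ^ 6)%N]/64%N; lia.
rewrite leq_exp2l // => j6.
have : j \in [:: 0; 1; 2; 3; 4; 5; 6]%N by case: (j) j6 => [|[|[|[|[|[|[|?]]]]]]].
rewrite !inE.
case/or4P => [/eqP j0|/eqP j1|/eqP j2|/or4P[] /eqP j3]; rewrite ?j0 ?j1 ?j2 ?j3 in jE; rewrite cR in jE.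
- by left; have := Qpm 1%N; rewrite cR jE => /(_ erefl); lia.
- lia.
- by right; left; have := Qpm 2%N; rewrite cR jE => /(_ erefl); lia.
- lia.
- by right; right; left; have := Qpm 4%N; rewrite cR jE => /(_ erefl); lia.
- lia.
- by right; right; right; have := Qpm 8%N; rewrite cR jE => /(_ erefl); lia.
Qed.

Lemma sum_herm_sum : \sum_(i < 3) Q i \in [:: 0; 3%:R * (2 * q)%:R; - (3%:R * (2 * q)%:R)].
Proof.
have [tau tauE] := pow2_rmorphism cardL2 2.
have [rho rhoE] := pow2_rmorphism cardL2 e.+1.
have rE x : rho x = bar x ^+ 2 by rewrite rhoE expnSr exprM.
have rho_a : rho (bar gam ^+ 8) = (gam ^+ 4) ^+ 4.
  by rewrite rE (barX (bar gam)) barK -!exprM.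
have rho_b : rho (gam ^+ 4) = bar gam ^+ 8 by rewrite rE (barX gam) -!exprM.
have bar_F4 (x : L) : x ^+ 4 = x -> bar x = x.
  have -> : bar x = x ^+ (4 ^ e./2).
    by rewrite /bar /q -{1}(odd_double_half e) (negPf e_even) add0n -mul2n expnM.
  by move=> x4; elim: (e./2) => [|k IHk]; rewrite ?expr1 // expnSr exprM IHk.
have rho_F4 (x : L) : x ^+ 4 = x -> rho x = x ^+ 2 by move=> x4; rewrite rE bar_F4.
have := class_roots_dichotomy e_gt0 cardL4 tauE rho_a rho_b rho_F4 om_prim g_om.
case=> [[i0 i0_gt0 others] | all1].
  rewrite (bigD1 i0) //=.
  have -> : \sum_(i < 3 | i != i0) Q i = 2%:R * q%:R.
    rewrite (eq_bigr (fun=> q%:R)) ?sumr_const ?cardC1 ?card_ord ?mulr_natl // => i /others Mi.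
    by have := herm_sum_cases i; rewrite /R Mi; lia.
  have := herm_sum_cases i0; rewrite /R !inE; lia.
rewrite (eq_bigr (fun=> - (2%:R * q%:R))) => [|i _]; last first.
  by have := herm_sum_cases i; rewrite /R all1; lia.
rewrite sumr_const card_ord !inE; lia.
Qed.

End ClassSums.

End Sums.

(** * From the Walsh transform to Hermitian sums *)

Lemma sigma_exp3 (e : nat) (q := (2 ^ e)%N) :
  ~~ odd e -> (3 * sigma_exp q = q ^ 2 + q + 1)%N.
Proof.
move=> e_even; have q3 : (q = 1 %[mod 3])%N := modn_q3 e_even.
rewrite /sigma_exp mulnC divnK // (divn_eq q 3) q3; apply/dvdnP.
set k := (q %/ 3)%N; by exists (3 * k * k + 3 * k + 1)%N; lia.
Qed.

Lemma sigma_expE (e : nat) (q := (2 ^ e)%N) :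
  ~~ odd e -> sigma_exp q = (1 + (q - 1) * ((q + 2) %/ 3))%N.
Proof.
move=> e_even; have := sigma_exp3 e_even; have q3 : (q = 1 %[mod 3])%N := modn_q3 e_even.
rewrite -/q; have qE : q = (3 * (q %/ 3) + 1)%N by rewrite {1}(divn_eq q 3) q3 mulnC.
set k := (q %/ 3)%N in qE; rewrite qE.
have -> : ((3 * k + 1 + 2) %/ 3 = k + 1)%N by lia.
nia.
Qed.

Section WalshReduction.

Variables (L : finFieldType) (e : nat) (om g : L).
Let q := (2 ^ e)%N.
Hypothesis e_even : ~~ odd e.
Hypothesis cardL : #|L| = (q ^ 2)%N.
Hypothesis om_prim : 3.-primitive_root om.
Hypothesis g_om : g ^+ geom4 e = om.
Hypothesis g_bar : g ^+ q = g.

Let cardL2 : #|L| = (2 ^ (e * 2))%N.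
Proof. by rewrite cardL expnM. Qed.

Let cardL4 : #|L| = (4 ^ e)%N.
Proof. by rewrite cardL2 mulnC expnM. Qed.

Let two0 := two0 cardL2.
Let chiD := chiD cardL2.
Let bar : L -> L := qconj e.
Let barD : forall x y, bar (x + y) = bar x + bar y := barD cardL.
Let barM : forall x y, bar (x * y) = bar x * bar y := @barM L e.
Let barK : involutive bar := barK cardL.
Let om_rel : om ^+ 2 + om + 1 = 0 := om_rel om_prim.
Let om_bar : bar om = om := om_bar e_even om_prim.

(** The exponent of sigma is 1 modulo q - 1. *)
Lemma expf_sigma_exp_bar (x : L) : bar x = x -> x ^+ sigma_exp q = x.
Proof.
move=> bx; rewrite (sigma_expE e_even) -/q exprD expr1 exprM.
have [->|x0] := eqVneq x 0; first by rewrite mul0r.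
suff -> : x ^+ (q - 1) = 1 by rewrite expr1n mulr1.
by apply: (mulfI x0); rewrite -exprS mulr1 subn1 prednK ?q_gt0.
Qed.

(** Substituting G^3 / (p bar p) for x turns the power x^d into the rational
    expression G^2 bar G / (p bar p), because 3 d = q^2 + q + 1. *)
Lemma sigma_param (p : L) : p != 0 ->
  let G := p + om ^+ 2 * bar p in
  sigma q (G ^+ 3 / (p * bar p)) = om ^+ 2 * p + om * bar p.
Proof.
move=> p0 G; have bp0 : bar p != 0 by rewrite /bar bar_eq0.
have bG : bar G = bar p + om ^+ 2 * p.
  by rewrite /G barD barM barK; congr (_ + _ * _); rewrite /bar barX -/bar om_bar.
have D0 : p * bar p != 0 by rewrite mulf_neq0.
have bD : bar (p * bar p) = p * bar p by rewrite barM barK mulrC.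
have Gd : (G ^+ 3 / (p * bar p)) ^+ sigma_exp q = G ^+ 2 * bar G / (p * bar p).
  rewrite exprMn exprVn (expf_sigma_exp_bar bD) -exprM (sigma_exp3 e_even); congr (_ / _).
  by rewrite addn1 exprS exprD -cardL expf_card mulrA -expr2.
rewrite /sigma exprM Gd.
have -> : (G ^+ 2 * bar G / (p * bar p)) ^+ q = bar G ^+ 2 * G / (p * bar p).
  rewrite -[LHS]/(bar _) barM -{2}bD; congr (_ * _).
    by rewrite barM barK /bar barX.
  by rewrite /bar /qconj exprVn -/q.
(* G^2 + G bar G + (bar G)^2 factors over om, and the factors are bar p and
   om^2 p.  The multiples of 2, om^2 + om + 1 and om^3 - 1 below vanish. *)
have key : G ^+ 3 + G ^+ 2 * bar G + bar G ^+ 2 * G = (om ^+ 2 * p + om * bar p) * (p * bar p).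
  have om3' : om ^+ 3 - 1 = 0 by rewrite (om3 om_prim) subrr.
  have f1 : G + om * bar G = bar p.
    transitivity (bar p + (om ^+ 2 + om + 1) * bar p + (om ^+ 3 - 1) * p + 2%:R * (p - bar p)).
      by rewrite bG /G; ring.
    by rewrite om_rel om3' two0 !mul0r !addr0.
  have f2 : G + om ^+ 2 * bar G = om ^+ 2 * p.
    transitivity (om ^+ 2 * p + (om ^+ 2 + om + 1) * p + (om ^+ 3 - 1) * (om * p)
      + 2%:R * (om ^+ 2 * bar p - om ^+ 2 * p)); first by rewrite bG /G; ring.
    by rewrite om_rel om3' two0 !mul0r !addr0.
  transitivity (G * ((G + om * bar G) * (G + om ^+ 2 * bar G)
      - (om ^+ 2 + om + 1) * (G * bar G) - (om ^+ 3 - 1) * bar G ^+ 2 + 2%:R * (G * bar G))).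
    by ring.
  rewrite om_rel om3' two0 !mul0r f1 f2 !subr0 addr0.
  transitivity ((om ^+ 2 * p + om * bar p) * (p * bar p) + (om ^+ 3 - 1) * (om * p * bar p ^+ 2)).
    by rewrite /G; ring.
  by rewrite om3' mul0r addr0.
by rewrite -!mulrDl key mulfK.
Qed.

Lemma sigma0 : sigma q (0 : L) = 0.
Proof.
by rewrite /sigma exprM (sigma_expE e_even) add1n !expr0n /= gtn_eqF ?q_gt0 // !addr0.
Qed.

Lemma bar_om_lin (p : L) : bar (om ^+ 2 * p + om * bar p) = om ^+ 2 * bar p + om * p.
Proof.
have bar_om2 : bar (om ^+ 2) = om ^+ 2 by rewrite /bar barX -/bar om_bar.
by rewrite barD (barM (om ^+ 2)) (barM om) barK om_bar bar_om2.
Qed.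

Lemma om_lin_inj : injective (fun p : L => om ^+ 2 * p + om * bar p).
Proof.
apply: (can_inj (g := fun p : L => om ^+ 2 * p + om * bar p)) => p /=.
rewrite bar_om_lin.
transitivity (p + (om ^+ 3 - 1) * (om * p) + (om ^+ 2 + om + 1) * p
  + 2%:R * (om ^+ 3 * bar p - p)); first by ring.
by rewrite (om3 om_prim) subrr om_rel two0 !mul0r !addr0.
Qed.

(** The monomial p^(5 - 2q), written as a quotient so that its value at 0 is 0. *)
Definition mono (p : L) : L := p ^+ 7 / (p * bar p) ^+ 2.

(** Expanding G^9 = (p^8 + om^16 (bar p)^8) (p + om^2 bar p), the terms p^9 and
    (bar p)^9 are conjugate and cancel under the trace; the two others are
    om^2 v and om bar v with v = alpha p^7 / (p bar p)^2, and om^2 + om = 1. *)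
Lemma chi_sigma_param (alpha p : L) : bar alpha = alpha -> p != 0 ->
  chi (alpha * ((p + om ^+ 2 * bar p) ^+ 3 / (p * bar p)) ^+ 3) = chi (alpha * mono p).
Proof.
move=> balpha p0; have bp0 : bar p != 0 by rewrite /bar bar_eq0.
pose D := p * bar p; have D0 : D != 0 by rewrite mulf_neq0.
have bD : bar D = D by rewrite /D barM barK mulrC.
have bX x n : bar (x ^+ n) = bar x ^+ n by exact: barX.
have bV x : bar x^-1 = (bar x)^-1 by rewrite /bar /qconj exprVn.
pose u := alpha * (p ^+ 9 / D ^+ 3); pose v := alpha * mono p.
have bu : bar u = alpha * (bar p ^+ 9 / D ^+ 3).
  by rewrite /u (barM alpha) (barM (p ^+ 9)) balpha bV (bX p) (bX D) bD.
have bv : bar v = alpha * (bar p ^+ 7 / D ^+ 2).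
  by rewrite /v /mono -/D (barM alpha) (barM (p ^+ 7)) balpha bV (bX p) (bX D) bD.
have G9 : (p + om ^+ 2 * bar p) ^+ 9
    = (p ^+ 8 + om ^+ 16 * bar p ^+ 8) * (p + om ^+ 2 * bar p).
  have D8 : (p + om ^+ 2 * bar p) ^+ 8 = p ^+ 8 + (om ^+ 2 * bar p) ^+ 8.
    exact: (exprD_pow2 cardL2 3).
  rewrite exprSr D8 exprMn -exprM //.
have om16 : om ^+ 16 = om by rewrite -(prim_expr_mod om_prim) expr1.
have om18 : om ^+ 18 = 1 by rewrite -(prim_expr_mod om_prim) expr0.
have -> : alpha * ((p + om ^+ 2 * bar p) ^+ 3 / D) ^+ 3
    = (u + bar u) + (om ^+ 2 * v + om * bar v).
  rewrite exprMn -exprM G9 om16 bu bv /u /v /mono -/D.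
  transitivity (alpha * (p ^+ 9 + om ^+ 3 * bar p ^+ 9
      + om ^+ 2 * (p ^+ 7 * D) + om * (bar p ^+ 7 * D)) / D ^+ 3).
    by rewrite /D exprVn; field; rewrite p0 bp0.
  by rewrite (om3 om_prim); field; rewrite ?p0 ?bp0 ?D0.
rewrite chiD (chiD u) chi_bar // (chi_chi cardL2) mul1r chiD.
have -> : chi (om * bar v) = chi (om * v).
  by rewrite -{1}om_bar -[bar om * bar v]barM chi_bar.
rewrite -chiD; congr (chi _).
transitivity (v + (om ^+ 2 + om + 1) * v - 2%:R * v); first by ring.
by rewrite om_rel two0 !mul0r addr0 subr0.
Qed.

Section Walsh.

Variables b beta : L.
Hypothesis b_bar : bar b = b.
Hypothesis b0 : b != 0.

Let gam := (om ^+ 2 * beta + om * bar beta) / b.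

Lemma walsh_mono :
  walsh (f_alpha e_even cardL (b ^+ 3)) beta = \sum_p chi (mono p) * chi (gam * p).
Proof.
have bV : bar b^-1 = b^-1 by rewrite /bar /qconj exprVn -/q -[X in X^-1]/(bar b) b_bar.
have inj : injective (fun p : L => om ^+ 2 * (p / b) + om * bar (p / b)).
  move=> x y /om_lin_inj /mulIf; apply; exact: invr_neq0.
rewrite /walsh (reindex_inj inj) /=; apply: eq_bigr => p _.
rewrite sign_F2D; congr (_ * _); last first.
  rewrite -/(chi _) mulrDr chiD.
  have -> : chi (beta * (om * bar (p / b))) = chi (om * bar beta * (p / b)).
    rewrite -[RHS](chi_bar cardL) -/bar; congr (chi _).
    by rewrite -/bar !barM om_bar barK; ring.
  by rewrite -chiD; congr (chi _); rewrite /gam; field.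
rewrite /f_alpha -/(chi _).
have [-> | p0] := eqVneq p 0.
  rewrite mul0r /bar (bar0 L e) !mulr0 addr0 /mono expr0n mul0r.
  have -> : ((sigma_perm e_even cardL)^-1)%g 0 = 0.
    by rewrite -{1}sigma0 -[sigma _ _](permE (sigma_inj e_even cardL)) permK.
  by rewrite expr0n mulr0.
have pb0 : p / b != 0 by rewrite mulf_neq0 ?invr_neq0.
rewrite -(sigma_param pb0) -[sigma _ _](permE (sigma_inj e_even cardL)) permK.
rewrite chi_sigma_param //; last by rewrite /bar barX -/bar b_bar.
congr (chi _); rewrite /mono barM bV.
have bp0 : bar p != 0 by rewrite /bar bar_eq0.
by field; rewrite p0 bp0.
Qed.

(** The map y |-> y^(q+2) = y^2 bar y has the same kernel as the cube map. *)
Lemma exp_q2_eq1 (v : L) : (v ^+ (q + 2) == 1) = (v ^+ 3 == 1).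
Proof.
have [k qE] : exists k, (q + 2 = 3 * k)%N.
  have q3 := modn_q3 e_even; rewrite -/q in q3.
  by exists ((q %/ 3).+1)%N; rewrite {1}(divn_eq q 3) q3; lia.
apply/eqP/eqP => [vq | v3]; last by rewrite qE exprM v3 expr1n.
have v0 : v != 0.
  apply/eqP => v0; move: vq; rewrite v0 addn2 expr0n /= => /eqP.
  by rewrite eq_sym oner_eq0.
have bv : bar v * v ^+ 2 = 1 by rewrite -exprD.
have bv2 : v * bar v ^+ 2 = 1.
  rewrite -{1}(barK v) /bar -barX -/bar -barM bv /bar /qconj expr1n //.
have vbv : bar v = v.
  apply: (mulfI (_ : v * bar v != 0)); first by rewrite mulf_neq0 // /bar bar_eq0.
  by rewrite -mulrA -expr2 bv2 mulrAC -expr2 mulrC bv.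
by rewrite exprS -{1}vbv.
Qed.

Lemma walsh_herm_sum :
  3%:R * walsh (f_alpha e_even cardL (b ^+ 3)) beta = \sum_(i < 3) herm_sum e (g ^+ i) gam.
Proof.
have g0 : g != 0 := g_neq0 om_prim g_om.
pose H p := chi (mono p) * chi (gam * p).
have chi00 := chi0 cardL2.
have H0 : H 0 = 1 by rewrite /H /mono expr0n mul0r mulr0 chi00 mulr1.
have -> : walsh (f_alpha e_even cardL (b ^+ 3)) beta = 1 + \sum_(p | p != 0) H p.
  by rewrite walsh_mono -/(H _) (bigD1 0) //= -/(H 0) H0.
rewrite mulrDr mulr1 -(sum_classes cardL4 om_prim g_om exp_q2_eq1 H).
have -> : 3%:R = \sum_(i < 3) (1 : int) by rewrite sumr_const card_ord.
rewrite -big_split /=; apply: eq_bigr => i _.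
rewrite /herm_sum [RHS](bigD1 0) //= herm0 ?chi00; congr (_ + _).
apply: eq_bigr => y y0; rewrite /H -chiD; congr (chi _).
have bg : bar (g ^+ i) = g ^+ i by rewrite /bar barX /qconj g_bar.
have by0 : bar y != 0 by rewrite /bar bar_eq0.
have gi0 : g ^+ i != 0 by rewrite expf_neq0.
have yE : y ^+ (q + 2) = bar y * y ^+ 2 by rewrite exprD.
have byE : bar (bar y * y ^+ 2) = y * bar y ^+ 2 by rewrite barM barK /bar barX.
rewrite /mono /herm yE barM bg byE -/bar.
by field; rewrite gi0 y0 by0.
Qed.

End Walsh.

End WalshReduction.

(** A non-cube of the subfield of order q: the norm of a non-cube of L, since
    q + 1 is prime to 3. *)
Lemma exists_cubic_nonresidue (L : finFieldType) (e : nat) :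
  (0 < e)%N -> ~~ odd e -> #|L| = ((2 ^ e) ^ 2)%N ->
  exists g : L, 3.-primitive_root (g ^+ geom4 e) /\ g ^+ (2 ^ e) = g.
Proof.
move=> e_gt0 e_even cardL; set q := (2 ^ e)%N in cardL *.
have cardL4 : #|L| = (4 ^ e)%N by rewrite cardL /q -expnM mulnC expnM.
have m3 := geom4E e; rewrite -cardL4 in m3.
have m_gt0 : (0 < geom4 e)%N by case: (e) e_gt0.
have [/existsP[z /andP[z0 zm]] | ] := boolP [exists z : L, (z != 0) && (z ^+ geom4 e != 1)].
  exists (z ^+ (q + 1)); split; last first.
    by rewrite -exprM mulnDl mul1n exprD mulnn -cardL expf_card addn1 exprS.
  have z3 : (z ^+ geom4 e) ^+ 3 = 1.
    by apply: (mulfI z0); rewrite mulr1 -exprM mulnC -exprS m3 expf_card.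
  have [m mP m_dvd] := prim_order_exists (isT : (0 < 3)%N) z3.
  have m_eq3 : m = 3%N.
    move: m_dvd; rewrite dvdn_divisors // inE => /predU1P[m1 | ]; last by rewrite inE => /eqP.
    by move: zm; rewrite -[_ ^+ geom4 e]expr1 -{1}m1 (prim_expr_order mP) eqxx.
  rewrite -exprM mulnC exprM prim_root_exp_coprime -?m_eq3 // m_eq3.
  have q3 : (q = 1 %[mod 3])%N := modn_q3 e_even.
  by rewrite coprime_sym prime_coprime // /dvdn -modnDml q3.
rewrite negb_exists => /forallP all1.
have := max_poly_roots (p := 'X^(geom4 e) - 1 : {poly L}) (rs := enum (predC1 (0 : L))).
rewrite size_Xn_sub_1 // -cardE cardC1 -m3 enum_uniq -size_poly_eq0 size_Xn_sub_1 //=.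
have -> : all (root ('X^(geom4 e) - 1)) (enum (predC1 (0 : L))).
  apply/allP => z; rewrite mem_enum inE /= => z0; have := all1 z; rewrite z0 /= negbK => /eqP z1.
  by rewrite /root !hornerE ?hornerXn z1 subrr.
by move=> /(_ isT isT isT); lia.
Qed.

(** * Distribution of the Walsh coefficients and nonlinearity *)

Section WalshSpectrum.

Variables (L : finFieldType) (n : nat) (f : L -> 'F_2).
Hypothesis cardL : #|L| = (2 ^ n)%N.

Let sg (x : L) : int := (-1) ^+ f x.

Let sg_sqr x : sg x * sg x = 1.
Proof. by rewrite -expr2 sqrr_sign. Qed.

Lemma walshE b : walsh f b = \sum_x sg x * chi (b * x).
Proof. by apply: eq_bigr => x _; rewrite sign_F2D. Qed.

Lemma sum_walsh : \sum_b walsh f b = (2 ^ n)%:R * (-1) ^+ f 0.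
Proof.
under eq_bigr => b _ do rewrite walshE.
rewrite exchange_big (bigD1 0) //= [X in _ + X]big1 => [|x x0].
  rewrite addr0 -/(sg 0) (eq_bigr (fun=> sg 0)) => [|b _]; last by rewrite mulr0 (chi0 cardL) mulr1.
  by rewrite sumr_const cardL mulr_natl.
rewrite -mulr_sumr; under eq_bigr => b _ do rewrite mulrC.
by rewrite (sum_chiM cardL) (negPf x0) mulr0.
Qed.

Lemma sum_walsh_sqr : \sum_b walsh f b ^+ 2 = (2 ^ n)%:R ^+ 2.
Proof.
transitivity (\sum_x \sum_y \sum_b sg x * sg y * chi ((x + y) * b)).
  transitivity (\sum_b \sum_x \sum_y sg x * sg y * chi ((x + y) * b)).
    apply: eq_bigr => b _; rewrite expr2 walshE mulr_suml; apply: eq_bigr => x _.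
    rewrite mulr_sumr; apply: eq_bigr => y _.
    by rewrite mulrDl (chiD cardL) ![_ * b]mulrC; ring.
  by rewrite exchange_big; apply: eq_bigr => x _; rewrite exchange_big.
rewrite (eq_bigr (fun=> (2 ^ n)%:R)) => [|x _].
  by rewrite sumr_const cardL expr2 -natrM -mulrnA.
rewrite (bigD1 x) //= [X in _ + X]big1 => [|y yx]; last first.
  by rewrite -mulr_sumr (sum_chiM cardL) addr_eq0 (oppxx cardL) eq_sym (negPf yx) mulr0.
by rewrite addr0 -mulr_sumr (sum_chiM cardL) (addxx cardL) eqxx sg_sqr mul1r.
Qed.

Lemma hamming_dist_affine b eps :
  (2 * hamming_dist f (affine_fun (b, eps)))%:R = (2 ^ n)%:R - (-1) ^+ eps * walsh f b :> int.
Proof.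
have -> : (2 ^ n)%:R = \sum_(x : L) (1 : int) by rewrite sumr_const cardL.
rewrite /hamming_dist -sum1_card natrM natr_sum big_mkcond /= !mulr_sumr -sumrB.
apply: eq_bigr => x _; rewrite inE /affine_fun /=.
case: (F2_cases (f x)) => ->; case: (F2_cases (absTr (b * x))) => ->;
  by case: (F2_cases eps) => ->.
Qed.

End WalshSpectrum.

Lemma bigmin_natP (T : finType) (F : T -> nat) (p0 p1 : T) (m : nat) :
  (forall p, m <= F p)%N -> F p1 = m -> \big[minn/F p0]_p F p = m.
Proof.
move=> lbm Fp1; apply/eqP; rewrite eqn_leq; apply/andP; split.
  rewrite -Fp1; have : p1 \in index_enum T by rewrite mem_index_enum.
  elim: (index_enum T) => //= p s IHs; rewrite inE big_cons => /predU1P[<-|/IHs].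
    by rewrite geq_minl.
  by apply: leq_trans; rewrite geq_minr.
by elim/big_ind: _ => // x y mx my; rewrite leq_min mx.
Qed.

Theorem corollary1p3 (e : nat) (e_ge2 : (2 <= e)%N) (e_even : ~~ odd e)
    (L : finFieldType) (cardL : #|L| = ((2 ^ e) ^ 2)%N)
    (alpha : L)
    (alpha_cube : exists b : L,
       [/\ b \in subFq (2 ^ e), b != 0 & alpha = b ^+ 3]) :
  let q : nat := (2 ^ e)%N in
  let f : L -> 'F_2 := f_alpha e_even cardL alpha in
  [/\ plateaued 2 f,
      [/\ #|[set b : L | walsh f b == (2 * q)%:R]| = ((q * (q + 2)) %/ 8)%N,
          #|[set b : L | walsh f b == - (2 * q)%:R]| = ((q * (q - 2)) %/ 8)%N
        & #|[set b : L | walsh f b == 0]| = ((3 * q ^ 2) %/ 4)%N]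
    & nonlinearity f = (q ^ 2 %/ 2 - q)%N].
Proof.
case: alpha_cube => b [b_sub b0 ->] q f.
have e_gt0 : (0 < e)%N by lia.
have cardL2 : #|L| = (2 ^ (e * 2))%N by rewrite cardL expnM.
have [k qE] : exists k, q = (4 * k)%N.
  by exists (2 ^ (e - 2))%N; rewrite /q -{1}(subnKC e_ge2) expnD.
have q_gt0 : (0 < q)%N by exact: q_gt0.
have [g [om_prim g_bar]] := exists_cubic_nonresidue e_gt0 e_even cardL.
have walshP beta : walsh f beta \in [:: 0; (2 * q)%:R; - (2 * q)%:R].
  have := sum_herm_sum e_gt0 e_even cardL om_prim erefl g_bar
   (((g ^+ geom4 e) ^+ 2 * beta + (g ^+ geom4 e) * qconj e beta) / b).
  rewrite -(walsh_herm_sum e_even cardL om_prim erefl g_bar beta _ b0); last first.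
    by move: b_sub; rewrite inE => /eqP.
  rewrite -/f !inE => /or3P[] /eqP wE; apply/or3P; [constructor 1|constructor 2|constructor 3];
   apply/eqP; lia.
have f0 : f 0 = 0.
  have s0 : ((sigma_perm e_even cardL)^-1)%g 0 = 0.
    by rewrite -{1}(sigma0 L e_even) -[sigma _ _](permE (sigma_inj e_even cardL)) permK.
  by rewrite /f /f_alpha s0 expr0n mulr0 (absTr0 cardL2).
(* q = 4 k, and np, nm, nz count the values 2 q, - 2 q and 0. *)
pose np := #|[set b : L | walsh f b == (2 * q)%:R]|.
pose nm := #|[set b : L | walsh f b == - (2 * q)%:R]|.
pose nz := #|[set b : L | walsh f b == 0]|.
have sum_ind (v : int) : #|[set b : L | walsh f b == v]|%:R = \sum_b (walsh f b == v)%:R :> int.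
  rewrite -sum1_card natr_sum big_mkcond; apply: eq_bigr => x _; rewrite inE.
  by case: (_ == _).
pose v : int := (2 * q)%:R; have v_gt0 : 0 < v by rewrite /v; lia.
have wcase beta (P : int -> Prop) : P 0 -> P v -> P (- v) -> P (walsh f beta).
  by move=> P0 Pp Pm; have := walshP beta; rewrite !inE => /or3P[] /eqP ->.
have neq : ((0 == v) = false) * ((0 == - v) = false) * ((v == - v) = false)
    * ((- v == v) = false) * ((v == 0) = false) * ((- v == 0) = false).
  by do !split; lia.
have E1 : v * (np%:R - nm%:R) = (q ^ 2)%:R :> int.
  have := sum_walsh f cardL2; rewrite f0 -cardL2 cardL mulr1 => <-.
  rewrite /np /nm !sum_ind -sumrB mulr_sumr; apply: eq_bigr => x _.
  by apply: (wcase x (fun w => v * ((w == v)%:R - (w == - v)%:R) = w));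
    rewrite ?neq ?eqxx /= ?mulr0n ?mulr1n; ring.
have E2 : v ^+ 2 * (np%:R + nm%:R) = (q ^ 2)%:R ^+ 2 :> int.
  have := sum_walsh_sqr f cardL2; rewrite -cardL2 cardL => <-.
  rewrite /np /nm !sum_ind -big_split mulr_sumr; apply: eq_bigr => x _.
  by apply: (wcase x (fun w => v ^+ 2 * ((w == v)%:R + (w == - v)%:R) = w ^+ 2));
    rewrite ?neq ?eqxx /= ?mulr0n ?mulr1n; ring.
have E3 : (np + nm + nz = q ^ 2)%N.
  apply/eqP; rewrite -(@eqr_nat int) !natrD -cardL -sum1_card natr_sum /np /nm /nz !sum_ind.
  rewrite -!big_split; apply/eqP; apply: eq_bigr => x _ /=.
  by apply: (wcase x (fun w => (w == v)%:R + (w == - v)%:R + (w == 0)%:R = 1));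
    rewrite ?neq ?eqxx /= ?mulr0n ?mulr1n; ring.
have diff : (np%:R - nm%:R = (2 * k)%:R :> int).
  apply: (mulfI (_ : v != 0)); first by rewrite neq.
  by rewrite E1 /v qE -natrM; congr (_%:R); ring.
have sum : (np + nm = 4 * k ^ 2)%N.
  apply/eqP; rewrite -(@eqr_nat int) natrD; apply/eqP.
  apply: (mulfI (_ : v ^+ 2 != 0)); first by rewrite expf_eq0 neq.
  by rewrite E2 /v qE -!natrX -natrM; congr (_%:R); ring.
have np_val : np = (2 * k ^ 2 + k)%N by lia.
have nm_val : (nm + k = 2 * k ^ 2)%N by lia.
have nz_val : nz = (12 * k ^ 2)%N by move: E3; rewrite sum qE; lia.
split.
- split; first by rewrite /ffdegree cardL2 pfactorK //; lia.
  move=> beta /=; have -> : 2 ^+ (ffdegree L + 2)./2 = v; last exact: walshP.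
  rewrite /v /ffdegree cardL2 pfactorK //.
  have -> : ((e * 2 + 2)./2 = e.+1)%N by lia.
  by rewrite -natrX expnS.
- split; rewrite -/np -/nm -/nz.
  + have -> : (q * (q + 2) = np * 8)%N by rewrite qE np_val; ring.
    by rewrite mulnK.
  + suff -> : (q * (q - 2) = nm * 8)%N by rewrite mulnK.
    have k_gt0 : (0 < k)%N by lia.
    by apply: (@addIn (k * 8)%N); rewrite -mulnDl nm_val qE; nia.
  + have -> : (3 * q ^ 2 = nz * 4)%N by rewrite qE nz_val; ring.
    by rewrite mulnK.
have [b1 b1E] : exists b1, walsh f b1 = v.
  have : (0 < np)%N by rewrite np_val; lia.
  by case/card_gt0P => b1; rewrite inE => /eqP; exists b1.
have q2E : (q ^ 2 = 2 * (8 * k ^ 2))%N by rewrite qE; ring.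
have -> : (q ^ 2 %/ 2 = 8 * k ^ 2)%N by rewrite q2E mulKn.
move: (k ^ 2)%N q2E => k2 q2E.
rewrite /nonlinearity; apply: (@bigmin_natP _ (fun p => hamming_dist f (affine_fun p)) _ (b1, 0)).
  case=> beta eps; have := hamming_dist_affine f cardL2 beta eps.
  rewrite -cardL2 cardL q2E; have := walshP beta; rewrite -/v !inE.
  move: (hamming_dist _ _) => dist; rewrite /v.
  case: (F2_cases eps) => ->; rewrite ?expr0 ?expr1 ?mul1r ?mulN1r;
    case/or3P => /eqP ->; lia.
have := hamming_dist_affine f cardL2 b1 0; rewrite b1E -cardL2 cardL q2E /= expr0 mul1r /v.
move: (hamming_dist _ _) => dist; lia.
Qed.
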